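(* Let $\mathscr{H}$ be a class of finite loop-free $k$-hypergraph structures that is closed under taking isomorphic copies of substructures and finite nonempty direct products, and that has bounded chromatic number (there is a finite $N$ such that every member of $\mathscr{H}$ has chromatic number at most $N$). If $k=2$ and $\mathscr{H}$ contains a graph that is not a disjoint union of complete bipartite graphs, or if $k>2$ and at least one member of $\mathscr{H}$ has a hyperedge, then $\mathscr{H}$ has no finite axiomatisation in first order logic amongst finite structures; that is, there is no finite set $\Sigma$ of first order sentences in the signature of one $k$-ary relation such that the finite models of $\Sigma$ are exactly the members of $\mathscr{H}$.
   Context: A hypergraph is a pair $(V,E)$ where $V$ is a set (of vertices) and $E$ is a set of nonempty subsets of $V$ (the hyperedges). It is loop-free if it has no singleton hyperedges. If $k$ is at least the maximal cardinality of the hyperedges of $(V,E)$, then $(V,E)$ is regarded as a relational structure $\langle V;r_E\rangle$ with one $k$-ary relation, where $(x_1,\dots,x_k)\in r_E$ if and only if $\{x_1,\dots,x_k\}\in E$. Such a structure is called a $k$-hypergraph structure. Substructures are induced substructures and direct products are taken in the usual model-theoretic sense. An $\ell$-colouring of $(V,E)$ is a map $\gamma:V\to\{0,1,\dots,\ell-1\}$ with $|\gamma(e)|\ge2$ for each $e\in E$; the chromatic number is the smallest $\ell$ for which an $\ell$-colouring exists. Loop-free $2$-hypergraph structures are simple graphs. In a disjoint union of complete bipartite graphs, a part of a complete bipartite graph may be empty, so isolated points and edgeless graphs are included. *)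

(* Defs.v *)
From mathcomp Require Import all_boot.
From Stdlib Require List.

Set Implicit Arguments.
Unset Strict Implicit.
Unset Printing Implicit Defensive.

(* Finite structures with one k-ary relation. The carrier may be empty. *)
Record kstructure (k : nat) : Type := KStructure {
  carrier :> finType;
  krel : {set k.-tuple carrier}
}.

Definition isomorphic k (A B : kstructure k) : Prop :=
  exists2 f : A -> B, bijective f &
    forall t : k.-tuple A, (t \in krel A) = (map_tuple f t \in krel B).

Definition substructure k (A : kstructure k) (S : {set A}) : kstructure k :=
  @KStructure k {x : A | x \in S}
    [set t : k.-tuple {x : A | x \in S} | map_tuple val t \in krel A].

Definition product k (I : finType) (A : I -> kstructure k) : kstructure k :=
  @KStructure k {dffun forall i : I, carrier (A i)}
    [set t : k.-tuple {dffun forall i : I, carrier (A i)} |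
       [forall i, map_tuple (fun f : {dffun forall i : I, carrier (A i)} => f i) t
                    \in krel (A i)]].

Definition disjoint_union k (I : finType) (A : I -> kstructure k) :
    kstructure k :=
  @KStructure k {i : I & carrier (A i)}
    [set t : k.-tuple {i : I & carrier (A i)} |
       [exists i, [exists s : k.-tuple (A i),
          (s \in krel (A i)) &&
          (t == map_tuple (@Tagged I i (fun i => carrier (A i))) s)]]].

(* A finite hypergraph on V is given by its set E : {set {set V}} of
   hyperedges. *)
Section Hypergraphs.

Variable V : finType.
Implicit Type E : {set {set V}}.

Definition is_hypergraph E : Prop := set0 \notin E.

Definition loop_free E : Prop := forall e, e \in E -> #|e| != 1.

Definition colourable E (l : nat) : Prop :=
  exists c : V -> 'I_l, forall e, e \in E -> 2 <= #|c @: e|.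

Definition is_chromatic_number E (l : nat) : Prop :=
  colourable E l /\ forall m, colourable E m -> l <= m.

Definition hypergraph_kstructure (k : nat) E : kstructure k :=
  @KStructure k V [set t : k.-tuple V | [set x in t] \in E].

End Hypergraphs.

(* A is (not merely up to isomorphism) the k-hypergraph structure of (A, E). *)
Definition kstructure_of k (A : kstructure k) (E : {set {set A}}) : Prop :=
  [/\ is_hypergraph E,
      forall e, e \in E -> #|e| <= k
    & krel A = krel (hypergraph_kstructure k E)].

(* The parts X and Y may be empty. For k = 2 this is the usual complete
   bipartite graph; leaving k arbitrary avoids casts along k = 2. *)
Definition complete_bipartite (k : nat) (X Y : finType) : kstructure k :=
  hypergraph_kstructure k
    [set [set inl p.1; inr p.2] | p : X * Y].

Definition disjoint_union_of_complete_bipartite k (A : kstructure k) : Prop :=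
  exists (I : finType) (X Y : I -> finType),
    isomorphic A (disjoint_union (fun i => complete_bipartite k (X i) (Y i))).

Section Classes.

Variables (k : nat) (K : kstructure k -> Prop).

Definition class_of_loop_free_hypergraphs : Prop :=
  forall A, K A -> exists2 E : {set {set A}}, kstructure_of E & loop_free E.

Definition closed_under_substructures : Prop :=
  forall (A B : kstructure k) (S : {set A}),
    K A -> isomorphic B (substructure S) -> K B.

Definition closed_under_products : Prop :=
  forall (I : finType) (A : I -> kstructure k),
    0 < #|I| -> (forall i, K (A i)) ->
    forall B, isomorphic B (product A) -> K B.

Definition bounded_chromatic_number : Prop :=
  exists N : nat, forall (A : kstructure k) (E : {set {set A}}),
    K A -> kstructure_of E ->
    exists2 l, is_chromatic_number E l & l <= N.

End Classes.

(* First-order formulas with equality over one k-ary relation symbol, with free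
   variables among 'I_n. Quantification binds variable 0 and shifts the others,
   so formula k 0 consists of exactly the sentences, whose satisfaction is
   meaningful also in the empty structure. The other connectives and the
   existential quantifier are definable classically. *)
Inductive formula (k : nat) : nat -> Type :=
| FFalse n : formula k n
| FEq n of 'I_n & 'I_n : formula k n
| FRel n of k.-tuple 'I_n : formula k n
| FImp n of formula k n & formula k n : formula k n
| FAll n of formula k n.+1 : formula k n.

Fixpoint sat k (A : kstructure k) n (phi : formula k n) : n.-tuple A -> Prop :=
  match phi in formula _ n return n.-tuple A -> Prop with
  | FFalse _ => fun _ => False
  | FEq _ i j => fun v => tnth v i = tnth v j
  | FRel _ s => fun v => map_tuple (tnth v) s \in krel A
  | FImp _ p q => fun v => sat p v -> sat q v
  | FAll _ p => fun v => forall a : A, sat p (cons_tuple a v)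
  end.

Definition sentence (k : nat) : Type := formula k 0.

Definition models k (A : kstructure k) (Sigma : seq (sentence k)) : Prop :=
  forall phi, List.In phi Sigma -> sat phi (nil_tuple A).

Definition finitely_axiomatisable_amongst_finite k
    (K : kstructure k -> Prop) : Prop :=
  exists Sigma : seq (sentence k), forall A : kstructure k,
    models A Sigma <-> K A.

(* Main.v *)
Require Import Defs.
From mathcomp Require Import all_boot perm zify.

(** Two finite structures are built for each finite set of sentences: one lies
    in the class, the other does not, and the sentences cannot tell them apart.

    Let the sentences have quantifier rank at most m, and let R be the radius up
    to which m rounds of an Ehrenfeucht-Fraisse game can see.  Take a finite
    k-uniform hypergraph E in which any 2R+1 edges form an acyclic family but
    which has no N-colouring, where N bounds the chromatic numbers occurring in
    the class ([sparse_forces_mono]).  The structure A is the disjoint union of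
    the balls of radius R of E, each ball taken m+1 times; the structure B is A
    together with one further component, a copy of E.

    - B is not in the class, since it has no N-colouring.
    - A and B satisfy the same sentences of rank at most m ([balls_equivalent]).
      When a move is made in the component E, or in any component of A, far from
      the earlier moves, it is answered at the same vertex of a ball that has
      not been used so far.  With m+1 copies of every ball there always is one,
      and the two vertices have isomorphic neighbourhoods.
    - A is in the class.  By sparsity of E each ball is a hyperforest
      ([ball_forest]), and every k-uniform hyperforest is in the class.

    For the last claim, a structure belongs to the class as soon as its
    homomorphisms into one member of the class separate its points and map each
    tuple outside its relation to a tuple outside the relation of that member
    ([in_class_of_homs]): it then embeds in a power of that member.  If k > 2,
    the target is a minimal hyperedge e of a member, and the homomorphisms are
    the strong k-colourings of the forest (injective on each edge) followed by
    surjections of the k colours onto e; for k > 2 a forest has enough strong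
    colourings because two vertices in no common edge can be given the same
    colour ([strong_nonedge]).  If k = 2, a member which is not a disjoint union of
    complete bipartite graphs contains a walk a, b, c, d whose ends are not
    adjacent ([rectangular_bipartite]), and such a walk separates the
    non-adjacent pairs of any bipartite graph ([forest_in_class_graph]).

    The hypergraph E comes from the partite construction of Nesetril and Rodl,
    by induction on the size of the families that have to be acyclic
    ([glued_sparse], [glued_settles]). *)

Set Implicit Arguments.
Unset Strict Implicit.
Unset Printing Implicit Defensive.

(* Instances of a cardinal or of a sum that agree only up to conversion count as
   distinct atoms for lia, hence their abstraction beforehand. *)
Ltac card_lia :=
  repeat match goal with |- context [bigop ?x ?r ?F] =>
    let s := fresh "s" in set s := (bigop x r F); move: s => s end;
  repeat match goal with |- context [card ?A] =>
    let c := fresh "c" in set c := (card A); move: c => c end;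
  clear; lia.

(** * Sparse families of sets *)

Definition uniform (V : finType) (k : nat) (E : {set {set V}}) : Prop :=
  forall e, e \in E -> #|e| = k.

(** Acyclicity in the sense of Berge for the families of at most l edges, as an
    Euler characteristic: a connected family S whose incidence graph is a tree
    covers one point more than the sum of #|e| - 1 over its edges, every cycle in
    it costs a point, and every further component gains one. *)
Definition sparse (V : finType) (l : nat) (E : {set {set V}}) : Prop :=
  forall S : {set {set V}}, S \subset E -> 0 < #|S| <= l ->
    (\sum_(e in S) #|e|).+1 <= #|cover S| + #|S|.

Definition monochromatic (V C : Type) (c : V -> C) (D : V -> Prop) : Prop :=
  exists a, forall v, D v -> c v = a.

Definition forces_mono (V : finType) (n : nat) (E : {set {set V}}) : Prop :=
  forall c : V -> 'I_n, exists2 e, e \in E &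
    monochromatic c (fun v => v \in e).

Lemma subset_of_card (T : finType) (A : {set T}) k :
  k <= #|A| -> exists2 B : {set T}, B \subset A & #|B| = k.
Proof.
move=> kA; exists [set x in take k (enum A)].
  by apply/subsetP=> x; rewrite inE => /mem_take; rewrite mem_enum.
rewrite cardsE (card_uniqP _) ?take_uniq ?enum_uniq //.
by rewrite size_take_min -cardE; apply/minn_idPl.
Qed.

Lemma pigeonhole k n (c : 'I_(k.-1 * n).+1 -> 'I_n) :
  exists2 K : {set 'I_(k.-1 * n).+1}, #|K| = k &
    monochromatic c (fun i => i \in K).
Proof.
case: (boolP [exists a, k <= #|[set i | c i == a]|]) => [/existsP[a ka]|].
  have [K sK cK] := subset_of_card ka; exists K => //.
  by exists a => i /(subsetP sK); rewrite inE => /eqP.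
rewrite negb_exists => /forallP small; exfalso.
have: #|'I_(k.-1 * n).+1| <= \sum_(a < n) k.-1.
  rewrite -sum1_card (partition_big c predT) //=; apply: leq_sum => a _.
  rewrite sum1dep_card.
  have := small a; rewrite -ltnNge => lt_k.
  rewrite -ltnS (ltn_predK lt_k); exact: lt_k.
by rewrite sum_nat_const !card_ord mulnC ltnn.
Qed.

(** Removing a point from an edge lowers the left-hand side by one and the right
    one by at most one. *)
Lemma sparse_shrink (V I : finType) (T : {set I}) (F G : I -> {set V}) :
  (forall i, i \in T -> G i \subset F i) ->
  (\sum_(i in T) #|F i|).+1 <= #|\bigcup_(i in T) F i| + #|T| ->
  (\sum_(i in T) #|G i|).+1 <= #|\bigcup_(i in T) G i| + #|T|.
Proof.
move=> GF.
have E1 : \sum_(i in T) #|F i| = \sum_(i in T) #|G i| + \sum_(i in T) #|F i :\: G i|.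
  rewrite -big_split; apply: eq_bigr => i iT.
  by rewrite -(cardsID (G i) (F i)) (setIidPr (GF i iT)).
have E2 : #|\bigcup_(i in T) F i| <= #|\bigcup_(i in T) G i| + \sum_(i in T) #|F i :\: G i|.
  have /subset_leq_card/leq_trans-> // : \bigcup_(i in T) F i \subset
     (\bigcup_(i in T) G i) :|: (\bigcup_(i in T) (F i :\: G i)).
    apply/subsetP=> x /bigcupP[i iT xF]; rewrite inE.
    case: (boolP (x \in G i)) => xG; first by apply/orP; left; apply/bigcupP; exists i.
    by apply/orP; right; apply/bigcupP; exists i => //; rewrite inE xG.
  apply: leq_trans (leq_card_setU _ _) _; rewrite leq_add2l.
  elim/big_rec2: _ => [|i m U _ le]; first by rewrite cards0.
  by apply: leq_trans (leq_card_setU _ _) _; rewrite leq_add2l.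
lia.
Qed.

Lemma sum_le1_cover (V I : finType) (T : {set I}) (G : I -> {set V}) :
  T != set0 -> (forall i, i \in T -> #|G i| <= 1) ->
  (\sum_(i in T) #|G i|).+1 <= #|\bigcup_(i in T) G i| + #|T|.
Proof.
move=> T0 G1.
have le : \sum_(i in T) #|G i| <= #|T|.
  by rewrite -sum1_card; apply: leq_sum.
case: (posnP (\sum_(i in T) #|G i|)) => [->|].
  by rewrite -card_gt0 in T0; lia.
rewrite lt0n sum_nat_eq0 negb_forall => /existsP[i].
rewrite negb_imply -lt0n => /andP[iT Gi].
have : 0 < #|\bigcup_(i in T) G i|.
  by apply: leq_trans Gi _; apply/subset_leq_card/bigcup_sup.
lia.
Qed.

(** * Gluing copies of a system along a row *)

Lemma pair_inj (S T : Type) (x : S) : injective (pair x : T -> S * T).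
Proof. by move=> ? ? []. Qed.

Section Gluing.

Variables (V Y R : finType) (E : {set {set V}}) (F : {set {set Y}}).
Variables (row : V -> R) (i : R).

(** The step of the partite construction: one copy of V for every edge f of F,
    where the row i of that copy is identified with f and the rest is private
    to f.  The vertices inr (f, v) with f outside F or with v in row i are
    isolated; allowing them avoids a dependent vertex type. *)
Definition glued : finType := (Y + ({set Y} * V))%type.

(** Positions in the enumerations of row i and of f provide the identification.
    The default value of nth is never reached for f in F, whose size is that
    of the row. *)
Definition glue_copy (f : {set Y}) (v : V) : glued :=
  if row v == i then
    nth (inr (f, v)) [seq inl y | y <- enum f] (index v (enum [set u | row u == i]))
  else inr (f, v).

Definition glued_row (x : glued) : R := if x is inr (_, v) then row v else i.

Definition glued_edges : {set {set glued}} :=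
  [set glue_copy f @: (e : {set V}) | f in F, e in E].

Hypothesis F_row : uniform #|[set v | row v == i]| F.

Lemma glue_copy_shared f v : f \in F -> row v = i ->
  exists2 y, y \in f & glue_copy f v = inl y.
Proof.
move=> fF rv; rewrite /glue_copy rv eqxx.
set j := index _ _.
have jf : j < size (enum f).
  by rewrite -cardE (F_row fF) cardE index_mem mem_enum inE rv.
have [y0 _] : exists y0 : Y, true by case: (enum f) jf => [|y0 s] //; exists y0.
exists (nth y0 (enum f) j); last by rewrite (nth_map y0).
by rewrite -mem_enum mem_nth.
Qed.

Lemma glue_copy_private f v : row v != i -> glue_copy f v = inr (f, v).
Proof. by rewrite /glue_copy => /negbTE->. Qed.

Lemma glue_copy_inj f : f \in F -> injective (glue_copy f).
Proof.
move=> fF u v.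
case: (eqVneq (row u) i) => ru; case: (eqVneq (row v) i) => rv.
- rewrite /glue_copy ru rv eqxx.
  set ju := index u _; set jv := index v _.
  have lt w : row w = i -> index w (enum [set u | row u == i]) < size (enum f).
    by move=> rw; rewrite -cardE (F_row fF) cardE index_mem mem_enum inE rw.
  have [y0 _] : exists y0 : Y, true.
    by case: (enum f) (lt _ ru) => [|y0 s] //; exists y0.
  rewrite !(nth_map y0) ?lt // => -[] /eqP.
  rewrite nth_uniq ?lt ?enum_uniq // => /eqP eq_j.
  have memw w : row w = i -> w \in enum [set u | row u == i].
    by move=> rw; rewrite mem_enum inE rw.
  by rewrite -(nth_index u (memw _ ru)) -/ju eq_j nth_index ?memw.
- by have [y _ ->] := glue_copy_shared fF ru; rewrite glue_copy_private.
- by have [y _ ->] := glue_copy_shared fF rv; rewrite glue_copy_private.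
- by rewrite !glue_copy_private // => -[].
Qed.

Lemma glued_row_copy f v : f \in F -> glued_row (glue_copy f v) = row v.
Proof.
move=> fF; case: (eqVneq (row v) i) => rv; last by rewrite glue_copy_private.
by have [y _ ->] := glue_copy_shared fF rv.
Qed.

Definition shared_part (W : {set V}) (f : {set Y}) : {set Y} :=
  [set y | inl y \in glue_copy f @: W].

Definition private_part (W : {set V}) : {set V} := [set v in W | row v != i].

Lemma shared_part_sub (W : {set V}) f : f \in F -> shared_part W f \subset f.
Proof.
move=> fF; apply/subsetP=> y; rewrite inE => /imsetP[v _].
case: (eqVneq (row v) i) => rv; last by rewrite glue_copy_private.
by have [z zf ->] := glue_copy_shared fF rv => -[->].
Qed.

Lemma card_parts (W : {set V}) f : f \in F ->
  #|W| = #|shared_part W f| + #|private_part W|.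
Proof.
move=> fF; rewrite -(card_imset W (glue_copy_inj fF)).
rewrite -(cardsID (inl @: [set: Y]) (glue_copy f @: W)); congr (_ + _).
  rewrite -(card_imset (shared_part W f) (@inl_inj Y ({set Y} * V)%type)).
  apply: eq_card => x; apply/setIP/imsetP => [[xW /imsetP[y _ xy]]|[y yW ->]].
    by exists y => //; rewrite inE -xy.
  by rewrite inE in yW; rewrite imset_f.
rewrite -(card_imset (private_part W) (glue_copy_inj fF)).
apply: eq_card => x; apply/setDP/imsetP => [[/imsetP[v vW ->] vi]|[v]].
  exists v => //; rewrite inE vW /=; apply: contraNneq vi => rv.
  by have [y _ ->] := glue_copy_shared fF rv; rewrite imset_f.
rewrite inE => /andP[vW rv] ->; rewrite imset_f //; split=> //.
by apply/imsetP=> -[y _]; rewrite glue_copy_private.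
Qed.

Lemma card_cover_copies (T : {set {set Y}}) (W : {set Y} -> {set V}) :
  T \subset F ->
  #|\bigcup_(f in T) glue_copy f @: W f| =
  #|\bigcup_(f in T) shared_part (W f) f| + \sum_(f in T) #|private_part (W f)|.
Proof.
move=> TF; set U := \bigcup_(f in T) _.
rewrite -(cardsID (inl @: [set: Y]) U); congr (_ + _).
  rewrite -(card_imset (\bigcup_(f in T) _) (@inl_inj Y ({set Y} * V)%type)).
  apply: eq_card => x; apply/setIP/imsetP => [[xU /imsetP[y _ xy]]|[y]].
    exists y => //; case/bigcupP: xU => f fT; rewrite xy => yW.
    by apply/bigcupP; exists f => //; rewrite inE.
  case/bigcupP=> f fT; rewrite inE => yW ->; split; last by rewrite imset_f.
  by apply/bigcupP; exists f.
pose P : {set glued} := [set inr p | p in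
  [set p : {set Y} * V | (p.1 \in T) && (p.2 \in private_part (W p.1))]].
have -> : U :\: inl @: [set: Y] = P.
  apply/setP=> x; apply/setDP/imsetP => [[/bigcupP[f fT /imsetP[v vW ->]] vi]|].
    have rv : row v != i.
      apply: contraNneq vi => rv.
      by have [y _ ->] := glue_copy_shared (subsetP TF _ fT) rv; rewrite imset_f.
    by exists (f, v); [rewrite !inE /= fT vW | rewrite glue_copy_private].
  case=> -[f v]; rewrite !inE /= => /and3P[fT vW rv] ->; split; last first.
    by apply/imsetP=> -[].
  by apply/bigcupP; exists f => //; rewrite -(glue_copy_private f rv) imset_f.
rewrite card_imset; last by move=> ? ? [].
rewrite -sum1_card.
rewrite (partition_big (fun p : {set Y} * V => p.1) (mem T)) /=; last first.
  by move=> p; rewrite inE => /andP[].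
apply: eq_bigr => f fT.
rewrite sum1dep_card -(card_imset (private_part (W f)) (@pair_inj _ _ f)).
apply: eq_card => -[g v]; rewrite inE /=; apply/andP/imsetP => [[]|[u uW [-> ->]]].
  by rewrite inE /= => /andP[_ vW] /eqP <-; exists v.
by rewrite inE /= fT uW.
Qed.

Lemma glued_edgeP s : reflect
  (exists2 f, f \in F & exists2 e, e \in E & s = glue_copy f @: (e : {set V}))
  (s \in glued_edges).
Proof.
apply: (iffP imset2P) => [[f e fF eE ->]|[f fF [e eE ->]]].
  by exists f => //; exists e.
by exists f e.
Qed.

Lemma glued_uniform k : uniform k E -> uniform k glued_edges.
Proof.
move=> Ek _ /glued_edgeP[f fF [e eE ->]].
by rewrite card_imset ?Ek //; apply: glue_copy_inj.
Qed.

Lemma glued_transversal :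
  (forall e, e \in E -> {in e &, injective row}) ->
  forall s, s \in glued_edges -> {in s &, injective glued_row}.
Proof.
move=> Er _ /glued_edgeP[f fF [e eE ->]] _ _ /imsetP[u ue ->] /imsetP[v ve ->].
by rewrite !glued_row_copy // => /(Er e eE _ _ ue ve) ->.
Qed.

(** Gluing gains one unit of sparsity.  A family S splits into subfamilies, one
    for each copy; T is the set of copies involved.  Sparsity inside each copy
    and sparsity of F, shrunk to the points of the shared row that are used, add
    up to the bound for S.  Sparsity of F applies if T has at most l elements.
    Otherwise every copy contributes a single edge, which meets the row in at
    most one point, and the bound for the shared part is trivial. *)
Lemma glued_sparse l :
  (forall e, e \in E -> {in e &, injective row}) ->
  sparse l.+1 E -> sparse l F -> sparse l.+1 glued_edges.
Proof.
move=> Er El Fl S SE Sl.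
(* An edge contained in the shared row may lie in several copies, so each edge is
   assigned to one of them. *)
pose own (s : {set glued}) (p : {set Y} * {set V}) :=
  [&& p.1 \in F, p.2 \in E & s == glue_copy p.1 @: p.2].
pose phi s := odflt (set0, set0) [pick p | own s p].
have phiP s : s \in S ->
    [/\ (phi s).1 \in F, (phi s).2 \in E & s = glue_copy (phi s).1 @: (phi s).2].
  move=> /(subsetP SE)/glued_edgeP[f fF [e eE s_fe]].
  rewrite /phi; case: pickP => [p /and3P[? ? /eqP] //|/(_ (f, e))].
  by rewrite /own /= fF eE s_fe eqxx.
pose T := [set (phi s).1 | s in S].
pose S_ f := [set s in S | (phi s).1 == f].
pose W f := cover [set (phi s).2 | s in S_ f].
have TF : T \subset F by apply/subsetP=> _ /imsetP[s /phiP[? _ _] ->].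
have inT s : s \in S -> (phi s).1 \in T by move=> sS; apply: imset_f.
have S_inj f : {in S_ f &, injective (fun s => (phi s).2)}.
  move=> s t; rewrite !inE => /andP[/phiP[_ _ es] /eqP fs] /andP[/phiP[_ _ et] /eqP ft] eq.
  by rewrite es et eq fs ft.
have cS : #|S| = \sum_(f in T) #|S_ f|.
  rewrite -sum1_card (partition_big (fun s => (phi s).1) (mem T)) //=.
  by apply: eq_bigr => f fT; rewrite sum1dep_card; apply: eq_card => s; rewrite !inE.
have sumS : \sum_(s in S) #|s| = \sum_(f in T) \sum_(s in S_ f) #|(phi s).2|.
  rewrite (partition_big (fun s => (phi s).1) (mem T)) //=.
  apply: eq_bigr => f fT; apply: eq_big => s; first by rewrite !inE.
  case/andP=> /phiP[fF _ es] _; rewrite {1}es card_imset //; exact: glue_copy_inj.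
have S_gt0 f : f \in T -> 0 < #|S_ f|.
  by case/imsetP=> s sS ->; apply/card_gt0P; exists s; rewrite !inE sS eqxx.
have S_le f : f \in T -> #|S_ f| <= #|S|.
  by move=> _; apply/subset_leq_card/subsetP=> s; rewrite inE => /andP[].
have cover_S : cover S = \bigcup_(f in T) glue_copy f @: W f.
  apply/setP=> x; apply/bigcupP/bigcupP=> [[s sS xs]|[f fT /imsetP[v]]].
    exists (phi s).1; first exact: inT.
    have [_ _ es] := phiP s sS; move: xs; rewrite {1}es => /imsetP[v ve ->].
    apply/imset_f/bigcupP; exists (phi s).2 => //.
    by apply: imset_f; rewrite !inE sS eqxx.
  case/bigcupP=> _ /imsetP[s sS ->] ve ->; move: sS; rewrite inE => /andP[sS /eqP fs].
  by exists s => //; have [_ _ ->] := phiP s sS; rewrite fs imset_f.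
have local f : f \in T -> (\sum_(s in S_ f) #|(phi s).2|).+1 <= #|W f| + #|S_ f|.
  move=> fT; have := El [set (phi s).2 | s in S_ f].
  rewrite big_imset ?card_in_imset //=; apply.
    by apply/subsetP=> e /imsetP[s]; rewrite inE => /andP[/phiP[_ ? _] _] ->.
  by rewrite S_gt0 //=; apply: leq_trans (S_le f fT) _; case/andP: Sl.
have T0 : T != set0.
  by case/andP: Sl => /card_gt0P[s sS] _; apply/set0Pn; exists (phi s).1; apply: inT.
have global : (\sum_(f in T) #|shared_part (W f) f|).+1 <=
    #|\bigcup_(f in T) shared_part (W f) f| + #|T|.
  have le_T : #|T| <= #|S| by apply: leq_imset_card.
  case: (leqP #|T| l) => Tl.
    apply: (@sparse_shrink _ _ _ id) => [f /(subsetP TF)|]; first exact: shared_part_sub.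
    by apply: Fl => //; rewrite Tl card_gt0 T0.
  apply: sum_le1_cover => // f fT.
  have S1 : #|S_ f| = 1.
    move: cS; rewrite (bigD1 f) //= => cS.
    have le : \sum_(g in T | g != f) 1 <= \sum_(g in T | g != f) #|S_ g|.
      by apply: leq_sum => g /andP[gT _]; apply: S_gt0.
    have cT : #|T| = 1 + \sum_(g in T | g != f) 1 by rewrite -sum1_card (bigD1 f).
    have := S_gt0 f fT; case/andP: Sl => _; rewrite cS cT in Tl *.
    move: le Tl; card_lia.
  have /cards1P[s eS] : #|S_ f| == 1 by rewrite S1.
  have : s \in S_ f by rewrite eS inE.
  rewrite inE => /andP[/phiP[_ eE _] _].
  rewrite /W eS imset_set1 /cover big_set1.
  apply/card_le1_eqP=> y z; rewrite !inE => /imsetP[u ue eu] /imsetP[v ve ev].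
  have fF := subsetP TF f fT.
  have := glued_row_copy u fF; have := glued_row_copy v fF.
  rewrite -eu -ev /= => ru rv.
  have := Er _ eE u v ue ve; rewrite -ru -rv => /(_ erefl) uv.
  by move: eu; rewrite uv -ev => -[].
rewrite sumS cS cover_S card_cover_copies //.
have : \sum_(f in T) (\sum_(s in S_ f) #|(phi s).2|).+1 <=
       \sum_(f in T) (#|shared_part (W f) f| + #|private_part (W f)| + #|S_ f|).
  apply: leq_sum => f fT; rewrite -card_parts ?local //; exact: (subsetP TF).
have -> : \sum_(f in T) (\sum_(s in S_ f) #|(phi s).2|).+1 =
    \sum_(f in T) \sum_(s in S_ f) #|(phi s).2| + #|T|.
  by rewrite -sum1_card -big_split; apply: eq_bigr => f _ /=; rewrite addn1.
rewrite !big_split /=; move: global; card_lia.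
Qed.

End Gluing.

(** * Sparse hypergraphs without colourings *)

(** What is achieved after i steps: in some copy of the initial system,
    which has an edge for each k-set K of rows, the first i rows are
    monochromatic.  The copy is only mentioned through its edges. *)
Definition settles (a n k : nat) (V : finType) (E : {set {set V}})
    (row : V -> 'I_a) (i : nat) : Prop :=
  forall c : V -> 'I_n, exists kappa : 'I_a -> 'I_n,
    forall K : {set 'I_a}, #|K| = k -> exists2 e, e \in E &
      row @: e = K /\ forall v, v \in e -> row v < i -> c v = kappa (row v).

(** F has an edge f coloured by a single colour, so row i is monochromatic in the
    copy of the system glued to f. *)
Lemma glued_settles a n k (V Y : finType) (E : {set {set V}})
    (F : {set {set Y}}) (row : V -> 'I_a) (i : 'I_a) :
  uniform #|[set v | row v == i]| F -> forces_mono n F ->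
  settles n k E row i -> settles n k (glued_edges E F row i) (@glued_row V Y _ row i) i.+1.
Proof.
move=> F_row F_mono E_i c.
have [f fF [b fb]] := F_mono (fun y => c (inl y)).
have [kappa kP] := E_i (fun v => c (glue_copy row i f v)).
exists (fun j => if j == i then b else kappa j) => K Kk.
have [e eE [eK ek]] := kP K Kk; exists (glue_copy row i f @: e).
  by apply/glued_edgeP; exists f => //; exists e.
split=> [|_ /imsetP[v ve ->]].
  rewrite -eK -imset_comp; apply: eq_in_imset => v _ /=.
  exact: (glued_row_copy F_row).
rewrite (glued_row_copy F_row) //; case: (eqVneq (row v) i) => rv.
  by have [y yf ->] := glue_copy_shared F_row fF rv; rewrite fb.
rewrite ltnS leq_eqVlt => /orP[/eqP eq_i|]; last exact: ek.
by case/eqP: rv; apply: val_inj.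
Qed.

Section InitialSystem.

Variables (a k : nat).

(** In the initial system the vertices of the edge on the rows K are tagged by K,
    which makes distinct edges disjoint. *)
Definition transversal_edge (K : {set 'I_a}) : {set {set 'I_a} * 'I_a} :=
  [set (K, j) | j in K].

Definition transversal_edges : {set {set {set 'I_a} * 'I_a}} :=
  [set transversal_edge K | K : {set 'I_a} & #|K| == k].

Lemma card_transversal_edge K : #|transversal_edge K| = #|K|.
Proof. by rewrite card_imset //; apply: pair_inj. Qed.

Lemma transversal_uniform : uniform k transversal_edges.
Proof.
by move=> e /imsetP[K]; rewrite inE => /eqP Kk ->; rewrite card_transversal_edge.
Qed.

Lemma transversal_injective e : e \in transversal_edges -> {in e &, injective snd}.
Proof.
by case/imsetP=> K _ -> _ _ /imsetP[u _ ->] /imsetP[v _ ->] /= ->.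
Qed.

Lemma transversal_sparse l : sparse l transversal_edges.
Proof.
move=> S SE /andP[S0 _].
suff /eqP tS : trivIset S by rewrite tS -addn1 leq_add2l.
apply/trivIsetP=> A B /(subsetP SE)/imsetP[K _ ->] /(subsetP SE)/imsetP[L _ ->] neq.
rewrite -setI_eq0 -subset0; apply/subsetP=> x /setIP[/imsetP[j _ ->] /imsetP[j' _ [KL _]]].
by case/eqP: neq; rewrite KL.
Qed.

Lemma transversal_settles n : 0 < a -> settles n k transversal_edges snd 0.
Proof.
move=> a0 c; exists (fun _ => c (set0, Ordinal a0)) => K Kk.
exists (transversal_edge K); first by apply: imset_f; rewrite inE Kk.
split=> //; apply/setP=> j; apply/imsetP/idP => [[_ /imsetP[i iK ->] ->] //|jK].
by exists (K, j) => //; apply: imset_f.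
Qed.

End InitialSystem.

(** The induction is on l, for all k at once, since the size of a row is the
    uniformity of the hypergraph along which copies are glued.  Once all rows
    are monochromatic, k of the (k - 1) n + 1 rows have the same colour. *)
Theorem sparse_forces_mono n l k : exists (V : finType) (E : {set {set V}}),
  [/\ uniform k E, sparse l E & forces_mono n E].
Proof.
elim: l k => [|l IHl] k.
  exists 'I_(k.-1 * n).+1, [set e : {set 'I_(k.-1 * n).+1} | #|e| == k]; split.
  - by move=> e; rewrite inE => /eqP.
  - by move=> S _; lia.
  - by move=> c; have [K Kk Kc] := pigeonhole c; exists K; rewrite // inE Kk.
pose a := (k.-1 * n).+1.
suff /(_ a (leqnn a)) : forall i, i <= a -> exists (V : finType)
    (E : {set {set V}}) (row : V -> 'I_a),
    [/\ uniform k E, sparse l.+1 E, forall e, e \in E -> {in e &, injective row}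
      & settles n k E row i].
  move=> [V [E [row [Ek El _ Ea]]]]; exists V, E; split=> // c.
  have [kappa kP] := Ea c; have [K Kk [b Kb]] := pigeonhole kappa.
  have [e eE [eK ek]] := kP K Kk; exists e => //; exists b => v ve.
  by rewrite ek // Kb // -eK imset_f.
elim=> [_|i IHi lt_i].
  exists ({set 'I_a} * 'I_a)%type, (transversal_edges a k), snd; split.
  - exact: transversal_uniform.
  - exact: transversal_sparse.
  - exact: transversal_injective.
  - exact: transversal_settles.
have [V [E [row [Ek El Er Ei]]]] := IHi (ltnW lt_i).
pose io := Ordinal lt_i.
have [Y [F [Fr Fl Fn]]] := IHl #|[set v | row v == io]|.
exists (glued V Y), (glued_edges E F row io), (@glued_row V Y _ row io); split.
- exact: glued_uniform.
- exact: glued_sparse.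
- exact: glued_transversal.
- exact: (@glued_settles _ _ _ _ _ _ _ _ io).
Qed.

(** * Balls and local isomorphisms *)

Section Balls.

Variables (V : finType) (E : {set {set V}}).
Implicit Types (S T : {set V}) (r s : nat).

Definition neighbourhood S : {set V} :=
  S :|: cover [set e in E | e :&: S != set0].

Definition ball r S : {set V} := iter r neighbourhood S.

Lemma ball_leq r s S : r <= s -> ball r S \subset ball s S.
Proof.
move=> /subnK <-; rewrite /ball iterD; elim: (s - r) => //= m IH.
by apply: subset_trans IH _; apply: subsetUl.
Qed.

Lemma sub_ball r S : S \subset ball r S.
Proof. exact: (@ball_leq 0). Qed.

Lemma ballD r s S : ball r (ball s S) = ball (r + s) S.
Proof. by rewrite /ball iterD. Qed.

Lemma ball_edge r S e x :
  e \in E -> x \in e -> x \in ball r S -> e \subset ball r.+1 S.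
Proof.
move=> eE xe xS; apply: subset_trans (subsetUr _ _).
by apply: (bigcup_sup e); rewrite inE eE; apply/set0Pn; exists x; rewrite inE xe.
Qed.

Lemma ballSP r S x : reflect
  (x \in ball r S \/
   exists e, [/\ e \in E, x \in e & exists2 y, y \in e & y \in ball r S])
  (x \in ball r.+1 S).
Proof.
apply: (iffP idP) => [|[xS|[e [eE xe [y ye yS]]]]].
- rewrite [ball _ _]/= inE => /orP[|/bigcupP[e]]; first by left.
  rewrite inE => /andP[eE /set0Pn[y /setIP[ye yS]]] xe; right.
  by exists e; split=> //; exists y.
- exact: (subsetP (ball_leq _ (leqnSn r))).
- exact: (subsetP (ball_edge eE ye yS)).
Qed.

Lemma ballU r S T : ball r (S :|: T) = ball r S :|: ball r T.
Proof.
elim: r => //= r ->; rewrite /neighbourhood; apply/setP=> x; rewrite !inE.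
apply/idP/idP.
  case/orP=> [/orP[->|->]|/bigcupP[e]]; rewrite ?orbT //.
  rewrite inE setIUr => /andP[eE /set0Pn[y]]; rewrite inE => yST xe.
  by case/orP: yST => yS; apply/orP; [left|right]; apply/orP; right; apply/bigcupP;
    exists e => //; rewrite inE eE; apply/set0Pn; exists y.
by case/orP=> /orP[->|/bigcupP[e]]; rewrite ?orbT // inE => /andP[eE /set0Pn[y yS]] xe;
  apply/orP; right; apply/bigcupP; exists e => //; rewrite inE eE setIUr;
  apply/set0Pn; exists y; rewrite inE yS ?orbT.
Qed.

Lemma ballS r S T : S \subset T -> ball r S \subset ball r T.
Proof. by move=> /setUidPr <-; rewrite ballU subsetUl. Qed.

Lemma ball_sym r x y : x \in ball r [set y] -> y \in ball r [set x].
Proof.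
elim: r x y => [|r IH] x y; first by rewrite !inE eq_sym.
case/ballSP=> [/IH|[e [eE xe [z ze /IH yz]]]].
  exact: (subsetP (ball_leq _ (leqnSn r))).
have zx : z \in ball 1 [set x].
  by apply: (subsetP (@ball_edge 0 _ _ x eE xe _)) => //; rewrite inE.
have : y \in ball r (ball 1 [set x]).
  by apply: (subsetP (ballS _ _)) yz; rewrite sub1set.
by rewrite ballD addn1.
Qed.

(** The radius r.+1 on the right also excludes an edge from the one ball to the
    other. *)
Lemma far_disjoint r S x z :
  x \notin ball (r.*2.+1) S -> z \in ball r [set x] -> z \notin ball r.+1 S.
Proof.
move=> far /ball_sym zx; apply: contra far => zS.
have : x \in ball r (ball r.+1 S).
  by apply: (subsetP (ballS _ _)) zx; rewrite sub1set.
by rewrite ballD addnS addnn.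
Qed.

End Balls.

Section HalfIso.

Variables (V1 V2 : finType) (E1 : {set {set V1}}) (E2 : {set {set V2}}).
Implicit Types (S : {set V1}) (T : {set V2}) (f : V1 -> V2) (g : V2 -> V1).

(** Half of an isomorphism between the balls of radius r around S and T.  Only S
    itself has to be mapped into T: edges inside the ball are preserved, so the
    ball is automatically mapped into the ball ([local_embedding_ball]). *)
Definition local_embedding r S T f g : Prop :=
  [/\ forall x, x \in S -> f x \in T,
      forall x, x \in ball E1 r S -> g (f x) = x
    & forall e, e \in E1 -> e \subset ball E1 r S -> f @: e \in E2].

Lemma local_embedding_ball r s S T f g x : local_embedding r S T f g ->
  s <= r -> x \in ball E1 s S -> f x \in ball E2 s T.
Proof.
move=> [fS _ fE]; elim: s x => [|s IH] x sr; first exact: fS.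
case/ballSP=> [/(IH _ (ltnW sr))|[e [eE xe [y ye yS]]]].
  exact: (subsetP (ball_leq _ _ (leqnSn s))).
have eS := ball_edge eE ye yS.
apply: (subsetP (@ball_edge _ E2 s T (f @: e) (f y) _ _ _)).
- exact: fE (subset_trans eS (ball_leq _ _ sr)).
- exact: imset_f.
- exact: IH (ltnW sr) yS.
- exact: imset_f.
Qed.

Lemma local_embedding_weaken r r' S S' T T' f g :
  local_embedding r S T f g -> ball E1 r' S' \subset ball E1 r S ->
  (forall x, x \in S' -> f x \in T') -> local_embedding r' S' T' f g.
Proof.
move=> [_ fg fE] sub fS'; split=> // [x /(subsetP sub)|e eE eS]; first exact: fg.
exact: fE (subset_trans eS sub).
Qed.

(** No edge joins the ball around c to the ball around S, so two embeddings on
    them can be used side by side. *)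
Lemma local_embedding_merge r S T f g c d f' g' :
  local_embedding r S T f g -> local_embedding r [set c] [set d] f' g' ->
  c \notin ball E1 r.*2.+1 S -> d \notin ball E2 r.*2.+1 T ->
  local_embedding r (c |: S) (d |: T)
    (fun x => if x \in ball E1 r [set c] then f' x else f x)
    (fun y => if y \in ball E2 r [set d] then g' y else g y).
Proof.
move=> fgH fgH' cS dT; have [fS fg fE] := fgH; have [fS' fg' fE'] := fgH'.
have far x : x \in ball E1 r S -> x \notin ball E1 r [set c].
  move=> xS; apply: contraL (subsetP (ball_leq _ _ (leqnSn r)) _ xS).
  exact: far_disjoint.
split=> [x|x|e eE].
- case/setU1P=> [->|xS]; rewrite inE.
    have cc : c \in [set c] by rewrite inE.
    by have := fS' c cc; rewrite (subsetP (sub_ball _ _ _)) // inE => ->.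
  by rewrite (negbTE (far _ _)) ?fS ?orbT // (subsetP (sub_ball _ _ _)).
- rewrite ballU inE => /orP[] xS.
    by rewrite xS (local_embedding_ball fgH' (leqnn r) xS) fg'.
  rewrite (negbTE (far _ xS)) ifN ?fg //.
  apply: contraL (local_embedding_ball fgH (leqnn r) xS) => fx.
  apply: contra (far_disjoint dT fx); exact: (subsetP (ball_leq _ _ (leqnSn r))).
- rewrite ballU => eS.
  case: (boolP (e :&: ball E1 r [set c] == set0)) => [e0|/set0Pn[z /setIP[ze zc]]].
    have out x : x \in e -> x \notin ball E1 r [set c].
      move=> xe; apply: contraTN e0 => xc; apply/set0Pn.
      by exists x; rewrite inE xe.
    have -> : (fun x => if x \in ball E1 r [set c] then f' x else f x) @: e = f @: e.
      by apply: eq_in_imset => x /out /negbTE ->.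
    apply: fE => //; apply/subsetP=> x xe.
    by have := subsetP eS x xe; rewrite inE (negbTE (out x xe)).
  have ec : e \subset ball E1 r [set c].
    apply/subsetP=> x xe; have := subsetP eS x xe; rewrite inE => /orP[//|xS].
    by have := far_disjoint cS zc; rewrite (subsetP (ball_edge eE xe xS)).
  have -> : (fun x => if x \in ball E1 r [set c] then f' x else f x) @: e = f' @: e.
    by apply: eq_in_imset => x /(subsetP ec) ->.
  exact: fE'.
Qed.

End HalfIso.

Section LocalIso.

Variables (V1 V2 : finType) (E1 : {set {set V1}}) (E2 : {set {set V2}}).

Definition local_iso r (S : {set V1}) (T : {set V2}) f g : Prop :=
  local_embedding E1 E2 r S T f g /\ local_embedding E2 E1 r T S g f.

Definition matched n r (a : n.-tuple V1) (b : n.-tuple V2) : Prop :=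
  exists f g, map_tuple f a = b /\ local_iso r [set x in a] [set y in b] f g.

(** Being at no finite distance from T, the vertex d lies in a component free of
    earlier moves; such a component has to exist as long as T has fewer than q
    vertices. *)
Definition far_extension (q r : nat) : Prop :=
  forall (c : V1) (T : {set V2}), #|T| < q ->
  exists (d : V2) f g, local_iso r [set c] [set d] f g /\
    forall m, d \notin ball E2 m T.

Lemma set_cons_tuple (V : finType) n (c : V) (a : n.-tuple V) :
  [set x in cons_tuple c a] = c |: [set x in a].
Proof. by apply/setP=> x; rewrite !inE. Qed.

Lemma matched_weaken n r r' (a : n.-tuple V1) b :
  r' <= r -> matched r a b -> matched r' a b.
Proof.
move=> le_r [f [g [ab [fg gf]]]]; exists f, g; split=> //.
have [fS _ _] := fg; have [gS _ _] := gf.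
split.
  by apply: local_embedding_weaken fg _ fS; apply: ball_leq.
by apply: local_embedding_weaken gf _ gS; apply: ball_leq.
Qed.

(** A round of the game.  If c is close to the earlier moves, its ball of radius
    r lies in the ball on which the local isomorphism is given.  Otherwise the
    answer is taken in a free component. *)
Lemma matched_extend n q R r (a : n.-tuple V1) b (c : V1) :
  far_extension q R -> n < q -> r <= R -> matched (3 * r).+1 a b ->
  exists d, matched r (cons_tuple c a) (cons_tuple d b).
Proof.
move=> far nq rR [f [g [ab [fg gf]]]].
case: (boolP (c \in ball E1 r.*2.+1 [set x in a])) => [near|cfar].
  exists (f c), f, g; split; first by apply: val_inj; rewrite /= -ab.
  have sub : ball E1 r (c |: [set x in a]) \subset ball E1 (3 * r).+1 [set x in a].
    rewrite ballU subUset; apply/andP; split; last by apply: ball_leq; lia.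
    have -> : (3 * r).+1 = r + r.*2.+1 by lia.
    by rewrite -ballD ballS // sub1set.
  have fnear : f c \in ball E2 r.*2.+1 [set y in b].
    by apply: local_embedding_ball fg _ near; lia.
  have sub' : ball E2 r (f c |: [set x in b]) \subset ball E2 (3 * r).+1 [set x in b].
    rewrite ballU subUset; apply/andP; split; last by apply: ball_leq; lia.
    have -> : (3 * r).+1 = r + r.*2.+1 by lia.
    by rewrite -ballD ballS // sub1set.
  rewrite !set_cons_tuple; split.
    apply: local_embedding_weaken (fg) sub _ => x /setU1P[->|]; first exact: setU11.
    by case: fg => fS _ _ /fS fx; apply: setU1r.
  apply: local_embedding_weaken (gf) sub' _ => x /setU1P[->|].
    have [_ fgc _] := fg; rewrite fgc ?setU11 //.
    by apply: (subsetP (ball_leq _ _ _)) near; lia.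
  by case: gf => gS _ _ /gS gx; apply: setU1r.
have [|d [f' [g' [[fg' gf'] dfar]]]] := far c [set y in b].
  by apply: leq_ltn_trans nq; rewrite cardsE -{2}(size_tuple b) card_size.
exists d; pose F x := if x \in ball E1 r [set c] then f' x else f x.
pose G y := if y \in ball E2 r [set d] then g' y else g y.
exists F, G.
have le1 : r <= (3 * r).+1 by lia.
have [fS _ _] := fg; have [gS _ _] := gf; have [fS' _ _] := fg'; have [gS' _ _] := gf'.
have fg1 : local_embedding E1 E2 r [set x in a] [set y in b] f g.
  by apply: local_embedding_weaken fg _ fS; apply: ball_leq.
have gf1 : local_embedding E2 E1 r [set x in b] [set y in a] g f.
  by apply: local_embedding_weaken gf _ gS; apply: ball_leq.
have fg1' : local_embedding E1 E2 r [set c] [set d] f' g'.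
  by apply: local_embedding_weaken fg' _ fS'; apply: ball_leq.
have gf1' : local_embedding E2 E1 r [set d] [set c] g' f'.
  by apply: local_embedding_weaken gf' _ gS'; apply: ball_leq.
have cc : c \in ball E1 r [set c] by rewrite (subsetP (sub_ball _ _ _)) ?inE.
split.
  apply: val_inj; rewrite /= /F cc -ab; congr (_ :: _).
    by have := fS' c (set11 c); rewrite inE => /eqP.
  apply/eq_in_map => x xa; rewrite ifN //.
  apply/negP=> /(far_disjoint cfar); apply/negP; rewrite negbK.
  by rewrite (subsetP (sub_ball _ _ _)) ?inE.
by rewrite !set_cons_tuple; split; apply: local_embedding_merge.
Qed.

End LocalIso.

Lemma matched_sym (V1 V2 : finType) (E1 : {set {set V1}}) (E2 : {set {set V2}})
    n r (a : n.-tuple V1) (b : n.-tuple V2) :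
  matched E1 E2 r a b -> matched E2 E1 r b a.
Proof.
move=> [f [g [ab [fg gf]]]]; exists g, f; split; last by split.
apply: val_inj; rewrite -ab /= -map_comp -[RHS]map_id.
apply/eq_in_map => x xa /=; case: fg => _ -> //.
by rewrite (subsetP (sub_ball _ _ _)) ?inE.
Qed.

(** * Transfer of sentences *)

Fixpoint rank k n (phi : formula k n) : nat :=
  match phi with
  | FFalse _ => 0
  | FEq _ _ _ => 0
  | FRel _ _ => 0
  | FImp _ p q => maxn (rank p) (rank q)
  | FAll _ p => (rank p).+1
  end.

(** The distance up to which t rounds can see: the recurrence is that of
    [matched_extend]. *)
Fixpoint radius (t : nat) : nat :=
  if t is t'.+1 then (3 * radius t').+1 else 0.

Lemma radius_leq s t : s <= t -> radius s <= radius t.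
Proof.
elim: t s => [|t IH] [|s] //= le_st; have := IH s le_st; lia.
Qed.

Section Transfer.

Variables (k : nat) (V1 V2 : finType).
Variables (E1 : {set {set V1}}) (E2 : {set {set V2}}).

Lemma sat_matched q R n (phi : formula k n) :
  far_extension E1 E2 q R -> far_extension E2 E1 q R ->
  n + rank phi <= q -> radius (rank phi) <= R ->
  forall (a : n.-tuple V1) (b : n.-tuple V2),
  matched E1 E2 (radius (rank phi)) a b ->
  @sat k (hypergraph_kstructure k E1) n phi a <->
  @sat k (hypergraph_kstructure k E2) n phi b.
Proof.
move=> far12 far21.
elim: phi => {n} [n|n i j|n s|n p IHp p' IHp'|n p IHp] /= nq rR a b ab.
- by [].
- have [f [g [<- [[_ fg _] _]]]] := ab; rewrite !tnth_map.
  have ba x : g (f (tnth a x)) = tnth a x by rewrite fg // inE mem_tnth.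
  by split=> [->|eq_f] //; rewrite -(ba i) eq_f ba.
- have trans : forall (W1 W2 : finType) (D1 : {set {set W1}}) (D2 : {set {set W2}})
      (u : n.-tuple W1) (v : n.-tuple W2), matched D1 D2 0 u v ->
      map_tuple (tnth u) s \in krel (hypergraph_kstructure k D1) ->
      map_tuple (tnth v) s \in krel (hypergraph_kstructure k D2).
    move=> W1 W2 D1 D2 u v [f [g [<- [[_ _ fE] _]]]].
    rewrite !inE => /fE.
    have -> : f @: [set x in map_tuple (tnth u) s] =
              [set x in map_tuple (tnth (map_tuple f u)) s].
      apply/setP=> y; rewrite !inE; apply/imsetP/mapP => [[x]|[i is_ ->]].
        rewrite inE => /mapP[i is_ ->] ->; exists i => //; by rewrite tnth_map.
      exists (tnth u i); last by rewrite tnth_map.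
      by rewrite inE; apply: map_f.
    apply; apply/subsetP=> x; rewrite inE => /mapP[i _ ->].
    by rewrite /= inE mem_tnth.
  by split; apply: trans => //; apply: matched_sym.
- have nq1 : n + rank p <= q by lia.
  have nq2 : n + rank p' <= q by lia.
  have le1 := radius_leq (leq_maxl (rank p) (rank p')).
  have le2 := radius_leq (leq_maxr (rank p) (rank p')).
  have [] := IHp nq1 (leq_trans le1 rR) a b (matched_weaken le1 ab).
  have [] := IHp' nq2 (leq_trans le2 rR) a b (matched_weaken le2 ab).
  tauto.
- have nq1 : n.+1 + rank p <= q by lia.
  have nq2 : n < q by lia.
  have rR1 : radius (rank p) <= R by lia.
  split=> sat_p x.
    have [y yx] := matched_extend x far21 nq2 rR1 (matched_sym ab).
    by apply/(IHp nq1 rR1 _ _ (matched_sym yx)).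
  have [y xy] := matched_extend x far12 nq2 rR1 ab.
  by apply/(IHp nq1 rR1 _ _ xy).
Qed.

End Transfer.

(** * Balls of sparse hypergraphs are forests *)

(** Every nonempty subfamily has a leaf: an edge that meets the other ones in at
    most one point.  This is acyclicity without reference to cycles. *)
Definition is_forest (V : finType) (E : {set {set V}}) : Prop :=
  forall S : {set {set V}}, S \subset E -> S != set0 ->
  exists2 e, e \in S & exists2 a, a \in e &
    forall f, f \in S -> f != e -> e :&: f \subset [set a].

Section Trees.

Variables (V : finType) (E : {set {set V}}) (x : V).

(** Families that are connected together with the point x, in the form in which
    they are built up from x edge by edge. *)
Inductive rooted : {set {set V}} -> Prop :=
| RootedNil : rooted set0
| RootedCons S e v of rooted S & e \in E & v \in e & v \in x |: cover S :
    rooted (e |: S).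

Lemma cover_setU1 e (S : {set {set V}}) : cover (e |: S) = e :|: cover S.
Proof. by rewrite /cover bigcup_setU big_set1. Qed.

Lemma cover_setU (S T : {set {set V}}) : cover (S :|: T) = cover S :|: cover T.
Proof. exact: bigcup_setU. Qed.

Lemma rooted_sub S : rooted S -> S \subset E.
Proof.
elim=> [|T e v _ sub eE _ _]; first exact: sub0set.
by rewrite subUset sub1set eE.
Qed.

Lemma rootedU S T : rooted S -> rooted T -> rooted (S :|: T).
Proof.
move=> rS; elim=> [|T' e v _ rU eE ve vT]; first by rewrite setU0.
rewrite setUCA; apply: (RootedCons rU eE ve).
by move: vT; rewrite cover_setU !inE => /orP[->|->]; rewrite ?orbT.
Qed.

(** Each new edge adds at most #|e| - 1 points. *)
Lemma rooted_card S : rooted S ->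
  #|x |: cover S| + #|S| <= (\sum_(e in S) #|e|).+1.
Proof.
elim=> [|T e v _ IH eE ve vT].
  by rewrite /cover !big_set0 setU0 cards1 cards0.
case: (boolP (e \in T)) => eT.
  suff -> : e |: T = T by [].
  by apply/setUidPr; rewrite sub1set.
rewrite big_setU1 //= (cardsU1 e) eT cover_setU1 /=.
have -> : x |: (e :|: cover T) = e :|: (x |: cover T) by rewrite setUCA.
have := cardsUI e (x |: cover T).
have : 0 < #|e :&: (x |: cover T)| by apply/card_gt0P; exists v; rewrite inE ve.
move: IH; card_lia.
Qed.

(** A further edge meeting a connected family in two points would close a
    cycle. *)
Lemma sparse_rooted l S e : sparse l E -> rooted S -> #|S| < l ->
  e \in E -> e \notin S -> #|e :&: (x |: cover S)| <= 1.
Proof.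
move=> El rS Sl eE eS; have := El (e |: S).
rewrite subUset sub1set eE (rooted_sub rS) (cardsU1 e) eS big_setU1 //= add1n => /(_ isT Sl).
have := rooted_card rS; have := cardsUI e (x |: cover S).
have : #|cover (e |: S)| <= #|e :|: (x |: cover S)|.
  by rewrite cover_setU1; apply/subset_leq_card/setUS/subsetUr.
card_lia.
Qed.

Lemma ball_rooted r v : v \in ball E r [set x] -> exists S,
  [/\ rooted S, #|S| <= r, v \in x |: cover S & x |: cover S \subset ball E r [set x]].
Proof.
elim: r v => [|r IH] v.
  rewrite inE => /eqP ->; exists set0; split; first exact: RootedNil.
  - by rewrite cards0.
  - exact: setU11.
  - by rewrite /cover big_set0 setU0.
case/ballSP=> [/IH[S [rS Sr vS sub]]|[e [eE ve [y ye yr]]]].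
  exists S; split=> //; first exact: leqW.
  exact: subset_trans sub (ball_leq _ _ (leqnSn r)).
have [S [rS Sr yS sub]] := IH y yr.
exists (e |: S); split.
- exact: RootedCons rS eE ye yS.
- by rewrite cardsU1; move: Sr; case: (e \notin S) => /=; card_lia.
- by rewrite cover_setU1 !inE ve orbT.
- rewrite cover_setU1 setUCA subUset (ball_edge eE ye yr).
  exact: subset_trans sub (ball_leq _ _ (leqnSn r)).
Qed.

Lemma rooted_notin S (e : {set V}) v (B : {set V}) :
  x |: cover S \subset B -> v \in e -> v \notin B -> e \notin S.
Proof.
move=> sub ve vB; apply: contra vB => eS; apply: (subsetP sub).
by rewrite inE; apply/orP; right; apply/bigcupP; exists e.
Qed.

Section Spheres.

Variables (k l m : nat).
Hypotheses (Ek : uniform k E) (k_gt1 : 1 < k) (El : sparse l E).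
Hypothesis ml : m.*2.+2 < l.

(** Take v at distance m + 1 from x.  If two edges inside the ball contained v,
    then the first edge, and a second point of the other edge, could be linked
    to x by families of at most m + 1 edges each, and the other edge would meet
    the union of these families in two points. *)
Lemma sphere_parent v :
  v \in ball E m.+1 [set x] -> v \notin ball E m [set x] ->
  exists (g : {set V}) (w : V), [/\ w \in g, w \in ball E m [set x] &
    forall f, f \in E -> v \in f -> f \subset ball E m.+1 [set x] -> f = g].
Proof.
move=> /ballSP[->//|[g [gE vg [w wg wm]]]] vm; exists g, w; split=> // f fE vf fm.
apply/eqP; apply: contraNT vm => neq.
have [S [rS Sm wS Ssub]] := ball_rooted wm.
have rgS := RootedCons rS gE wg wS.
have vgS : v \in x |: cover (g |: S) by rewrite cover_setU1 !inE vg orbT.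
apply/negPn/negP => vm.
have fgS : f \notin g |: S.
  by rewrite in_setU1 negb_or neq (rooted_notin Ssub vf).
have cS : #|g |: S| <= m.+1 by rewrite cardsU1; move: Sm; case: (g \notin S) => /=; card_lia.
(* T links a second point u of f to x without using f. *)
have contra T u : rooted T -> #|T| <= m.+1 -> f \notin T -> u \in f -> u != v ->
    u \in x |: cover T -> False.
  move=> rT Tm fT uf uv uT.
  have : #|f :&: (x |: cover ((g |: S) :|: T))| <= 1.
    apply: (sparse_rooted El) => //; first exact: rootedU.
      have := cardsUI (g |: S) T; move: cS Tm ml; card_lia.
    by rewrite in_setU negb_or fgS.
  move/card_le1_eqP => /(_ u v).
  rewrite !inE uf vf cover_setU !inE.
  move: uT vgS; rewrite !inE => /orP[->|->] /orP[->|->]; rewrite ?orbT /= => /(_ isT isT) eq;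
    by rewrite eq eqxx in uv.
case: (boolP [exists u in f, u \in ball E m [set x]]) => [/exists_inP[u uf um]|].
  have [T [rT Tm uT Tsub]] := ball_rooted um.
  apply: (contra T u) => //; first exact: leqW.
    exact: (rooted_notin Tsub vf).
  by apply: contraNneq vm => <-.
rewrite negb_exists_in => /forall_inP none.
have [u /setD1P[uv uf]] : exists u, u \in f :\ v.
  by apply/card_gt0P; have := cardsD1 v f; rewrite vf (Ek fE); move: k_gt1; card_lia.
have /ballSP[um|[h [hE uh [w' wh wm']]]] := subsetP fm u uf.
  by have := none u uf; rewrite um.
have [T [rT Tm wT Tsub]] := ball_rooted wm'.
apply: (contra (h |: T) u) => //.
- exact: RootedCons rT hE wh wT.
- by rewrite cardsU1; move: Tm; case: (h \notin T) => /=; card_lia.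
- rewrite in_setU1 negb_or (rooted_notin Tsub vf) // andbT.
  by apply/eqP=> fh; have := none w'; rewrite fh wm' => /(_ wh).
- by rewrite cover_setU1 !inE uh orbT.
Qed.

(** An edge of S through a vertex v at the largest distance is a leaf: all its
    vertices but one have that distance, and they lie in no other edge of S. *)
Lemma sphere_leaf (S : {set {set V}}) : S \subset E ->
  cover S \subset ball E m.+1 [set x] -> ~~ (cover S \subset ball E m [set x]) ->
  exists2 e, e \in S & exists2 a, a \in e &
    forall f, f \in S -> f != e -> e :&: f \subset [set a].
Proof.
move=> SE Sm /subsetPn[v /bigcupP[e eS ve] vm].
have sub f : f \in S -> f \subset ball E m.+1 [set x].
  by move=> fS; apply: subset_trans Sm; apply: bigcup_sup.
have eE := subsetP SE e eS.
have [g [w [wg wm parent]]] := sphere_parent (subsetP (sub e eS) v ve) vm.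
have eg := parent e eE ve (sub e eS); rewrite -eg in wg parent => {g eg}.
exists e => //; exists w => // f fS fe; apply/subsetP=> u /setIP[ue uf].
case: (boolP (u \in ball E m [set x])) => um; last first.
  have [g [_ [_ _ parent_u]]] := sphere_parent (subsetP (sub e eS) u ue) um.
  have fg := parent_u f (subsetP SE f fS) uf (sub f fS).
  have eg := parent_u e eE ue (sub e eS).
  by rewrite fg eg eqxx in fe.
have [T [rT Tm uT Tsub]] := ball_rooted um.
have [T' [rT' Tm' wT Tsub']] := ball_rooted wm.
have : #|e :&: (x |: cover (T :|: T'))| <= 1.
  apply: (sparse_rooted El) => //; first exact: rootedU.
    by have := cardsUI T T'; move: Tm Tm' ml; card_lia.
  by rewrite in_setU negb_or (rooted_notin Tsub ve) ?(rooted_notin Tsub' ve).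
move/card_le1_eqP => /(_ u w).
rewrite !inE ue wg cover_setU !inE.
by move: uT wT; rewrite !inE => /orP[->|->] /orP[->|->]; rewrite ?orbT /= => /(_ isT isT) ->.
Qed.

End Spheres.

Lemma ball_forest k l R : uniform k E -> 1 < k -> sparse l E -> R.*2 < l ->
  is_forest [set e in E | e \subset ball E R [set x]].
Proof.
move=> Ek k1 El Rl S SE S0.
have SE' : S \subset E.
  by apply: subset_trans SE _; apply/subsetP=> e; rewrite inE => /andP[].
have exm : exists m, cover S \subset ball E m [set x].
  exists R; apply/bigcupsP=> e /(subsetP SE); by rewrite inE => /andP[].
case: (ex_minnP exm) => m Sm min_m.
have mR : m <= R.
  apply: min_m; apply/bigcupsP=> e /(subsetP SE); by rewrite inE => /andP[].
case: m Sm min_m mR => [|m] Sm min_m mR.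
  have [e eS] := set0Pn _ S0.
  have : #|e| <= #|[set x]|.
    by apply: subset_leq_card; apply: subset_trans Sm; apply: bigcup_sup.
  by rewrite cards1 (Ek _ (subsetP SE' e eS)) leqNgt k1.
apply: (sphere_leaf Ek k1 El (m := m)) => //; first by move: Rl mR; clear; lia.
by apply/negP=> /min_m; rewrite ltnn.
Qed.

End Trees.

(** * Disjoint unions of hypergraphs on the same vertex set *)

(** One component for each label j, with edge set D j.  Restricting edges and
    keeping all vertices avoids dependent types: vertices of V outside a
    component merely become isolated points. *)
Section Labelled.

Variables (V J : finType) (D : J -> {set {set V}}).

Definition layer (j : J) (e : {set V}) : {set V * J} := [set (v, j) | v in e].

Definition labelled : {set {set V * J}} := \bigcup_j [set layer j e | e in D j].

Lemma labelledP A :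
  reflect (exists j, exists2 e, e \in D j & A = layer j e) (A \in labelled).
Proof.
apply: (iffP bigcupP) => [[j _ /imsetP[e eD ->]]|[j [e eD ->]]].
  by exists j; exists e.
by exists j => //; apply: imset_f.
Qed.

Lemma mem_layer j e v i : ((v, i) \in layer j e) = (v \in e) && (i == j).
Proof.
apply/imsetP/andP=> [[u ue [-> ->]]|[ve /eqP ->]]; first by [].
by exists v.
Qed.

Lemma card_layer j e : #|layer j e| = #|e|.
Proof. by rewrite card_imset // => u v []. Qed.

Lemma labelled_uniform k : (forall j, uniform k (D j)) -> uniform k labelled.
Proof.
by move=> Dk A /labelledP[j [e eD ->]]; rewrite card_layer (Dk j).
Qed.

Lemma labelled_forest : (forall j, is_forest (D j)) -> is_forest labelled.
Proof.
move=> DF S SD /set0Pn[A AS].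
have [j [e0 e0D eA]] := labelledP _ (subsetP SD A AS).
have [||e] := DF j [set e in D j | layer j e \in S].
- by apply/subsetP=> e; rewrite inE => /andP[].
- by apply/set0Pn; exists e0; rewrite inE e0D -eA.
rewrite inE => /andP[eD eS] [a ae leaf]; exists (layer j e) => //.
exists (a, j); first by rewrite mem_layer ae eqxx.
move=> B BS neq; have [i [f fD eB]] := labelledP _ (subsetP SD B BS).
rewrite {}eB in BS neq *; apply/subsetP=> -[v h].
rewrite in_setI !mem_layer => /andP[/andP[ve /eqP ->] /andP[vf /eqP ji]]; subst i.
rewrite inE xpair_eqE eqxx andbT -in_set1; apply: (subsetP (leaf f _ _)).
- by rewrite inE fD.
- by apply: contraNneq neq => ->.
- by rewrite inE ve.
Qed.

Lemma ball_label m (T : {set V * J}) x :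
  x \in ball labelled m T -> exists2 t, t \in T & t.2 = x.2.
Proof.
elim: m x => [|m IH] x; first by move=> xT; exists x.
case/ballSP=> [/IH //|[e [/labelledP[j [e' _ ->]] xe [y ye /IH[t tT ty]]]]].
exists t => //; rewrite ty; case: x y xe ye {ty} => [v i] [u i'] /=.
by rewrite !mem_layer => /andP[_ /eqP ->] /andP[_ /eqP ->].
Qed.

Lemma ball_labelled m v j x : x \in ball labelled m [set (v, j)] ->
  x.2 = j /\ x.1 \in ball (D j) m [set v].
Proof.
elim: m x => [|m IH] x; first by rewrite inE => /eqP -> /=; rewrite inE.
case/ballSP=> [/IH[-> xm]|[e [/labelledP[i [e' eD ->]] xe [y ye /IH[yj ym]]]]].
  by split=> //; apply: (subsetP (ball_leq _ _ (leqnSn m))).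
case: x y xe ye yj ym => [u h] [w h'] /=; rewrite !mem_layer.
move=> /andP[ue /eqP hi] /andP[we /eqP hi'] yj wm.
subst h h' i; split=> //; exact: (subsetP (ball_edge eD we wm)).
Qed.

End Labelled.

(** Changing the label is a local isomorphism around (v, j1) as soon as both
    components have the same edges near v. *)
Lemma relabel_embedding (V J1 J2 : finType) (D1 : J1 -> {set {set V}})
    (D2 : J2 -> {set {set V}}) r v j1 j2 :
  set0 \notin labelled D1 ->
  (forall e, e \in D1 j1 -> e \subset ball (D1 j1) r [set v] -> e \in D2 j2) ->
  local_embedding (labelled D1) (labelled D2) r [set (v, j1)] [set (v, j2)]
    (fun x => (x.1, j2)) (fun x => (x.1, j1)).
Proof.
move=> D0 D12; split=> [x|[u j]|A AD sub].
- by rewrite !inE => /eqP ->.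
- by move/ball_labelled=> /= [-> _].
have [a aA] : exists a, a \in A by apply/set0Pn; apply: contraNneq D0 => <-.
have [j [e eD eA]] := labelledP _ _ AD.
have ej : j = j1.
  have [<- _] := ball_labelled (subsetP sub a aA).
  by move: aA; rewrite eA; case: (a) => u i; rewrite mem_layer => /andP[_ /eqP ->].
subst j; apply/labelledP; exists j2; exists e.
  apply: D12 => //; apply/subsetP=> u ue.
  have uA : (u, j1) \in A by rewrite eA mem_layer ue eqxx.
  by have [_] := ball_labelled (subsetP sub _ uA).
apply/setP=> -[u j]; rewrite mem_layer eA.
apply/imsetP/andP=> [[[w i]]|[ue /eqP ->]].
  by rewrite mem_layer => /andP[we _] [-> ->].
by exists (u, j1) => //; rewrite mem_layer ue eqxx.
Qed.

Section TwoStructures.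

Variables (V : finType) (E : {set {set V}}) (q R : nat).
Hypothesis E0 : set0 \notin E.

(** The label (x, i) carries the i-th copy of the ball of radius R around x; in
    [balls_and_whole] the label None carries the whole hypergraph. *)
Definition ball_edges (p : V * 'I_q) : {set {set V}} :=
  [set e in E | e \subset ball E R [set p.1]].

Definition balls_and_whole (p : option (V * 'I_q)) : {set {set V}} :=
  if p is Some p' then ball_edges p' else E.

Lemma fresh_copy (J : finType) (lab : V * 'I_q -> J) (T : {set V * J}) (y : V) :
  injective lab -> #|T| < q ->
  exists i, forall t, t \in T -> t.2 != lab (y, i).
Proof.
move=> lab_inj Tq.
suff /subsetPn[_ /imsetP[i _ ->] fresh] :
    ~~ ([set lab (y, i) | i : 'I_q] \subset [set t.2 | t in T]).
  by exists i => t tT; apply: contraNneq fresh => <-; apply: imset_f.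
apply/negP=> /subset_leq_card; rewrite card_imset; last by move=> i j /lab_inj[].
by rewrite card_ord leqNgt (leq_ltn_trans (leq_imset_card _ _)).
Qed.

Lemma ball_edges_in e p : e \in ball_edges p -> e \in E.
Proof. by rewrite inE => /andP[]. Qed.

Lemma labelled_set0 (J : finType) (D : J -> {set {set V}}) :
  (forall j, set0 \notin D j) -> set0 \notin labelled D.
Proof.
move=> D0; apply/negP=> /labelledP[j [e eD e0]].
have : #|layer j e| == 0 by rewrite -e0 cards0.
by rewrite card_layer cards_eq0 => /eqP ee; have := D0 j; rewrite -ee eD.
Qed.

Let D0 : set0 \notin labelled ball_edges.
Proof.
by apply: labelled_set0 => j; apply: contra E0; apply: ball_edges_in.
Qed.

Let D0' : set0 \notin labelled balls_and_whole.
Proof.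
by apply: labelled_set0 => -[j|] //; apply: contra E0; apply: ball_edges_in.
Qed.

Lemma fresh_far (J : finType) (D : J -> {set {set V}}) (T : {set V * J}) y j m :
  (forall t, t \in T -> t.2 != j) -> (y, j) \notin ball (labelled D) m T.
Proof.
by move=> fresh; apply/negP=> /ball_label[t /fresh] /= /eqP.
Qed.

Lemma far_extension_balls :
  far_extension (labelled ball_edges) (labelled balls_and_whole) q R.
Proof.
move=> [y [x i]] T Tq.
have [i' fresh] := @fresh_copy _ Some T x (@Some_inj _) Tq.
exists (y, Some (x, i')), (fun z => (z.1, Some (x, i'))), (fun z => (z.1, (x, i))).
split; last by move=> m; apply: fresh_far.
by split; apply: relabel_embedding.
Qed.

(** A vertex y of the whole hypergraph corresponds to the centre of the ball
    around y. *)
Lemma far_extension_whole :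
  far_extension (labelled balls_and_whole) (labelled ball_edges) q R.
Proof.
move=> [y [[x i]|]] T Tq.
  have [i' fresh] := @fresh_copy _ id T x (@inj_id _) Tq.
  exists (y, (x, i')), (fun z => (z.1, (x, i'))), (fun z => (z.1, Some (x, i))).
  split; last by move=> m; apply: fresh_far.
  by split; apply: relabel_embedding.
have [i' fresh] := @fresh_copy _ id T y (@inj_id _) Tq.
exists (y, (y, i')), (fun z => (z.1, (y, i'))), (fun z => (z.1, None)).
split; last by move=> m; apply: fresh_far.
split; apply: relabel_embedding => // e; last by move/ball_edges_in.
by rewrite /= inE => -> ->.
Qed.

Lemma balls_equivalent k (phi : sentence k) (v : V) :
  0 < q -> rank phi <= q -> radius (rank phi) <= R ->
  sat phi (nil_tuple (hypergraph_kstructure k (labelled ball_edges))) <->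
  sat phi (nil_tuple (hypergraph_kstructure k (labelled balls_and_whole))).
Proof.
move=> q0 phi_q phi_R.
apply: (sat_matched far_extension_balls far_extension_whole) => //.
exists (fun z => (z.1, Some z.2)), (fun z => (z.1, odflt (v, Ordinal q0) z.2)).
have nil_set (W : finType) : [set x in nil_tuple W] = set0.
  by apply/setP=> x; rewrite !inE.
have ball0 (W : finType) (F : {set {set W}}) r : ball F r set0 = set0.
  apply/setP=> x; elim: r x => [|r IH] x //; rewrite [RHS]inE.
  by apply/negP=> /ballSP[|[e [_ _ [y _]]]]; rewrite IH inE.
split; first exact: val_inj.
split; split=> [x|x|e eE]; rewrite nil_set ?ball0 ?inE // subset0 => /eqP e0.
  by have := D0; rewrite -e0 eE.
by have := D0'; rewrite -e0 eE.
Qed.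

End TwoStructures.

(** * Strong colourings of forests *)

Lemma forest_sub (V : finType) (E F : {set {set V}}) :
  F \subset E -> is_forest E -> is_forest F.
Proof. by move=> FE EF S SF; apply: EF; apply: subset_trans FE. Qed.

(** Forests are built by adding edges e that meet the earlier ones at most in a
    given point a. *)
Lemma forest_ind (V : finType) (P : {set {set V}} -> Prop) :
  P set0 ->
  (forall (E : {set {set V}}) (e : {set V}) (a : V), is_forest (e |: E) ->
     a \in e -> (forall f, f \in E -> e :&: f \subset [set a]) ->
     P E -> P (e |: E)) ->
  forall E, is_forest E -> P E.
Proof.
move=> P0 Pstep E; have [n] := ubnP #|E|; elim: n E => // n IH E En EF.
case: (eqVneq E set0) => [-> //|E0].
have [e eE [a ae leaf]] := EF E (subxx E) E0.
rewrite -(setD1K eE); apply: (Pstep _ _ a) => //.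
- by rewrite setD1K.
- by move=> f /setD1P[fe fE]; apply: leaf.
- apply: IH; last by apply: forest_sub EF; apply: subD1set.
  by move: En; rewrite (cardsD1 e) eE add1n ltnS.
Qed.

Section StrongColourings.

Variables (V : finType) (k : nat).
Implicit Types (E : {set {set V}}) (c : V -> 'I_k).

Definition strong E c : Prop := forall e, e \in E -> {in e &, injective c}.

Lemma edge_colouring (e : {set V}) (a : V) (i : 'I_k) :
  #|e| = k -> a \in e ->
  exists2 p : V -> 'I_k, {in e &, injective p} & p a = i.
Proof.
move=> ek ae.
pose p0 v := cast_ord ek (enum_rank_in ae v).
have p0_inj : {in e &, injective p0}.
  by move=> u v ue ve /cast_ord_inj/(can_in_inj (enum_rankK_in ae)); apply.
exists (fun v => tperm (p0 a) i (p0 v)); last exact: tpermL.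
by move=> u v ue ve /perm_inj; apply: p0_inj.
Qed.

Lemma edge_colouring2 (e : {set V}) (a x : V) (i j : 'I_k) :
  #|e| = k -> a \in e -> x \in e -> x != a -> j != i ->
  exists p : V -> 'I_k, [/\ {in e &, injective p}, p a = i & p x = j].
Proof.
move=> ek ae xe xa ji; have [p p_inj pa] := edge_colouring i ek ae.
exists (fun v => tperm (p x) j (p v)); split.
- by move=> u v ue ve /perm_inj; apply: p_inj.
- rewrite pa tpermD //; apply: contraNneq xa => px.
  by apply/eqP/p_inj; rewrite // pa.
- exact: tpermL.
Qed.

(** Only the points of e other than the attaching point a are recoloured, and
    they lie in no other edge. *)
Lemma strong_extend E (e : {set V}) a c p :
  a \in e -> (forall f, f \in E -> e :&: f \subset [set a]) ->
  strong E c -> {in e &, injective p} -> p a = c a ->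
  exists c', [/\ strong (e |: E) c', {in e, c' =1 p} &
    forall v, v \notin e :\ a -> c' v = c v].
Proof.
move=> ae leaf cE pe pa.
pose c' v := if v \in e then p v else c v.
have c'c v : v \notin e :\ a -> c' v = c v.
  rewrite /c' in_setD1 negb_and negbK => /orP[/eqP ->|/negbTE -> //].
  by rewrite ae.
have c'p : {in e, c' =1 p} by move=> v; rewrite /c' => ->.
exists c'; split=> // f /setU1P[->|fE] u v uf vf; first by rewrite !c'p //; apply: pe.
have out w : w \in f -> w \notin e :\ a.
  move=> wf; apply/negP=> /setD1P[wa we].
  have : w \in e :&: f by rewrite inE we.
  by move/(subsetP (leaf f fE)); rewrite inE (negbTE wa).
by rewrite !c'c ?out //; apply: (cE f).
Qed.

Lemma strong_exists E : 0 < k -> is_forest E -> uniform k E -> exists c, strong E c.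
Proof.
move=> k0; move: E; apply: forest_ind => [_|E e a _ ae leaf IH Ek].
  by exists (fun _ => Ordinal k0) => e; rewrite inE.
have [c cE] : exists c, strong E c.
  by apply: IH => f fE; apply: Ek; apply: setU1r.
have [p pe pa] := edge_colouring (c a) (Ek e (setU11 _ _)) ae.
by have [c' [c'E _ _]] := strong_extend ae leaf cE pe pa; exists c'.
Qed.

(** The third colour is used when x is a new point of the edge e and y is outside
    e: then x has to avoid the colours of both a and y. *)
Lemma strong_separates E : 2 < k -> is_forest E -> uniform k E ->
  forall x y, x != y -> exists2 c, strong E c & c x != c y.
Proof.
move=> k2; move: E; apply: forest_ind => [_ x y xy|E e a _ ae leaf IH Ek x y xy].
  have k0 : 0 < k by lia.
  have k1 : 1 < k by lia.
  exists (fun v => if v == x then Ordinal k0 else Ordinal k1).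
    by move=> e; rewrite inE.
  by rewrite eqxx (eq_sym y) (negbTE xy).
have {}IH u v : u != v -> exists2 c, strong E c & c u != c v.
  by apply: IH => f fE; apply: Ek; apply: setU1r.
have ek := Ek e (setU11 _ _).
have private u v : u != v -> u \in e :\ a ->
    exists2 c, strong (e |: E) c & c u != c v.
  move=> uv ua; have /setD1P[u_a ue] := ua.
  have [c cE _] := IH u v uv.
  case: (boolP (v \in e)) => ve.
    have [p pe pa] := edge_colouring (c a) ek ae.
    have [c' [c'E c'p _]] := strong_extend ae leaf cE pe pa.
    exists c' => //; apply: contraNneq uv => cuv.
    by apply/eqP; apply: (c'E e) => //; apply: setU11.
  have [j] : exists j, j \in [set~ c a] :\ c v.
    apply/card_gt0P; have := cardsD1 (c v) [set~ c a].
    have := cardsC1 (c a); rewrite card_ord; case: (_ \in _) => /=; move: k2; card_lia.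
  rewrite !inE => /andP[jv ja].
  have [p [pe pa pu]] := edge_colouring2 ek ae ue u_a ja.
  have [c' [c'E c'p c'c]] := strong_extend ae leaf cE pe pa.
  by exists c' => //; rewrite c'p // pu c'c // !inE negb_and ve orbT.
case: (boolP (x \in e :\ a)) => xa; first exact: private.
case: (boolP (y \in e :\ a)) => ya.
  have [|c cE cyx] := private y x _ ya; first by rewrite eq_sym.
  by exists c; rewrite // eq_sym.
have [c cE cxy] := IH x y xy.
have [p pe pa] := edge_colouring (c a) ek ae.
have [c' [c'E _ c'c]] := strong_extend ae leaf cE pe pa.
by exists c' => //; rewrite !c'c.
Qed.

(** If x is a new point of the edge e, then y is not the attaching point a.  A
    colouring of the earlier edges in which a and y have different colours
    leaves the colour of y available for x. *)
Lemma strong_merges E : 2 < k -> is_forest E -> uniform k E ->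
  forall x y, x != y -> (forall e, e \in E -> ~~ ((x \in e) && (y \in e))) ->
  exists2 c, strong E c & c x = c y.
Proof.
move=> k2; have k0 : 0 < k by lia.
move: E; apply: forest_ind => [_ x y _ _|E e a EF ae leaf IH Ek x y xy nadj].
  by exists (fun _ => Ordinal k0) => // e; rewrite inE.
have EF' : is_forest E by apply: forest_sub EF; apply: subsetUr.
have Ek' : uniform k E by move=> f fE; apply: Ek; apply: setU1r.
have ek := Ek e (setU11 _ _).
have private u v : u \in e :\ a -> v \notin e ->
    exists2 c, strong (e |: E) c & c u = c v.
  move=> /setD1P[u_a ue] ve.
  have va : v != a by apply: contraNneq ve => ->.
  have [c cE cva] := strong_separates k2 EF' Ek' va.
  have [p [pe pa pu]] := edge_colouring2 ek ae ue u_a cva.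
  have [c' [c'E c'p c'c]] := strong_extend ae leaf cE pe pa.
  by exists c' => //; rewrite c'p // pu c'c // !inE negb_and ve orbT.
have nadj_e := nadj e (setU11 _ _).
case: (boolP (x \in e :\ a)) => xa.
  apply: private => //; apply: contra nadj_e => ->.
  by case/setD1P: xa => _ ->.
case: (boolP (y \in e :\ a)) => ya.
  have [|c cE cyx] := private y x ya.
    by apply: contra nadj_e => ->; case/setD1P: ya => _ ->.
  by exists c.
have [|c cE cxy] := IH Ek' x y xy.
  by move=> f fE; apply: nadj; apply: setU1r.
have [p pe pa] := edge_colouring (c a) ek ae.
have [c' [c'E _ c'c]] := strong_extend ae leaf cE pe pa.
by exists c' => //; rewrite !c'c.
Qed.

(** A new point x of a leaf e lies in no other edge, so a k-set through x that is
    not e contains a point not adjacent to x. *)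
Lemma nonedge_nonadjacent E : 1 < k -> is_forest E -> uniform k E ->
  forall t : {set V}, #|t| = k -> t \notin E ->
  exists x y, [/\ x \in t, y \in t, x != y &
    forall e, e \in E -> ~~ ((x \in e) && (y \in e))].
Proof.
move=> k1; move: E; apply: forest_ind => [_ t tk _|E e a _ ae leaf IH Ek t tk].
  have /card_gt1P[x [y [xt yt xy]]] : 1 < #|t| by rewrite tk.
  by exists x, y; split=> // e; rewrite inE.
have ek := Ek e (setU11 _ _).
rewrite in_setU1 negb_or => /andP[te tE].
case: (boolP [exists x, (x \in t) && (x \in e :\ a)]) => [/existsP[x /andP[xt]]|].
  case/setD1P=> xa xe.
  have /subsetPn[y yt ye] : ~~ (t \subset e).
    by apply: contra te => te; rewrite eqEcard te ek tk leqnn.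
  exists x, y; split=> // [|f /setU1P[->|fE]]; first by apply: contraNneq ye => <-.
    by rewrite (negbTE ye) andbF.
  apply/negP=> /andP[xf _]; have : x \in e :&: f by rewrite inE xe.
  by move/(subsetP (leaf f fE)); rewrite inE (negbTE xa).
move=> none; have [|//|//|x [y [xt yt xy nadj]]] := IH _ t.
  by move=> f fE; apply: Ek; apply: setU1r.
exists x, y; split=> // f /setU1P[->|]; last exact: nadj.
apply: contra none => /andP[xe ye]; apply/existsP.
case: (eqVneq x a) => [xa|xa]; last by exists x; rewrite xt !inE xa.
by exists y; rewrite yt !inE ye -xa eq_sym xy.
Qed.

Lemma strong_nonedge E (t : {set V}) : 2 < k -> is_forest E -> uniform k E ->
  #|t| = k -> t \notin E -> exists2 c, strong E c & #|c @: t| < k.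
Proof.
move=> k2 EF Ek tk tE.
have [x [y [xt yt xy nadj]]] := nonedge_nonadjacent (ltnW k2) EF Ek tk tE.
have [c cE cxy] := strong_merges k2 EF Ek xy nadj; exists c => //.
have le_k : #|c @: t| <= k by apply: leq_trans (leq_imset_card _ _) _; rewrite tk.
rewrite ltn_neqAle le_k andbT; apply: contra xy => /eqP ct.
by apply/eqP; apply: (imset_injP _ x y xt yt cxy); rewrite ct tk.
Qed.

End StrongColourings.

(** * Membership in the class through homomorphisms *)

Section Representation.

Variables (k : nat) (K : kstructure k -> Prop).
Hypotheses (K_sub : closed_under_substructures K) (K_prod : closed_under_products K).

Definition homomorphism (A M : kstructure k) (h : A -> M) : Prop :=
  forall t : k.-tuple A, t \in krel A -> map_tuple h t \in krel M.

(** Evaluation embeds A in the power of M indexed by all homomorphisms. *)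
Lemma in_class_of_homs (A M : kstructure k) : K M ->
  (exists h : A -> M, homomorphism h) ->
  (forall x y : A, x != y -> exists2 h : A -> M, homomorphism h & h x != h y) ->
  (forall t : k.-tuple A, t \notin krel A ->
     exists2 h : A -> M, homomorphism h & map_tuple h t \notin krel M) ->
  K A.
Proof.
move=> KM [h0 hom0] sep nrel.
pose hom (h : {ffun A -> M}) :=
  [forall t : k.-tuple A, (t \in krel A) ==> (map_tuple h t \in krel M)].
have homP (h : A -> M) : homomorphism h -> hom (finfun h).
  move=> hh; apply/forallP=> t; apply/implyP=> /hh.
  suff -> : map_tuple (finfun h) t = map_tuple h t by [].
  by apply: eq_from_tnth => i; rewrite !tnth_map ffunE.
pose I : finType := {h : {ffun A -> M} | hom h}.
pose toI h (hh : homomorphism h) : I := exist (fun h => is_true (hom h)) _ (homP h hh).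
have I0 : 0 < #|I| by apply/card_gt0P; exists (toI _ hom0).
pose P := product (fun _ : I => M).
have KP : K P.
  apply: (K_prod I0 (fun _ => KM)).
  exists id => [|t]; first by exists id.
  by suff -> : map_tuple id t = t by []; apply: val_inj; rewrite /= map_id.
pose emb (x : A) : P := [ffun i : I => (val i : {ffun A -> M}) x].
pose S : {set P} := [set emb x | x : A].
have inS x : emb x \in S by apply: imset_f.
apply: (K_sub KP (S := S)).
exists (fun x => exist (fun y => is_true (y \in S)) (emb x) (inS x)).
  apply: inj_card_bij => [x y [] /ffunP exy|].
    apply/eqP; apply: contraT => /sep[h hh].
    have := exy (toI _ hh); rewrite !ffunE => ->.
    by rewrite eqxx.
  by rewrite card_sig /= leq_imset_card.
move=> t; rewrite !inE; apply/idP/forallP=> [tA i|all_i].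
  have /forallP/(_ t)/implyP/(_ tA) := valP i.
  set u := (X in _ -> X \in _); suff -> : u = map_tuple (val i) t by [].
  by apply: eq_from_tnth => j; rewrite !tnth_map /= ffunE.
apply: contraT => /nrel[h hh].
have := all_i (toI _ hh).
set u := map_tuple _ _; suff -> : map_tuple h t = u by move=> ->.
by apply: eq_from_tnth => j; rewrite !tnth_map /= ffunE /= ffunE.
Qed.

End Representation.

(** * Forests in the class: arity at least three *)

Lemma set_map_tuple (S T : finType) n (f : S -> T) (t : n.-tuple S) :
  [set y in map_tuple f t] = f @: [set x in t].
Proof.
apply/setP=> y; rewrite inE; apply/mapP/imsetP=> [[x xt ->]|[x]].
  by exists x; rewrite // inE.
by rewrite inE; exists x.
Qed.

Lemma tuple_of_set (T : finType) n (e : {set T}) :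
  0 < #|e| <= n -> exists t : n.-tuple T, [set x in t] = e.
Proof.
case/andP=> /card_gt0P[x xe] en.
have sz : size (enum e ++ nseq (n - #|e|) x) == n.
  by rewrite size_cat size_nseq -cardE subnKC.
exists (Tuple sz); apply/setP=> y; rewrite inE /= mem_cat mem_enum mem_nseq.
by case: (boolP (y \in e)) => //= ye; apply/andP=> -[_ /eqP yx]; rewrite yx xe in ye.
Qed.

Lemma card_set_tuple (T : finType) n (t : n.-tuple T) : #|[set x in t]| <= n.
Proof. by rewrite cardsE -{2}(size_tuple t) card_size. Qed.

Section LargeArity.

Variables (k : nat) (K : kstructure k -> Prop).
Hypotheses (K_sub : closed_under_substructures K) (K_prod : closed_under_products K).

(** The colour i is sent to a; the other k - 1 colours are enough to cover the
    rest of e, which is not empty, so they can all avoid a. *)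
Lemma surjection_isolating (T : finType) (e : {set T}) (a : T) (i : 'I_k) :
  a \in e -> 1 < #|e| <= k ->
  exists2 s : 'I_k -> T, s @: [set: 'I_k] = e & forall j, s j = a -> j = i.
Proof.
case: k i => [[]//|k'] i ae /andP[e1 ek].
have [|t te] := @tuple_of_set _ k' (e :\ a).
  by move: (cardsD1 a e) e1 ek; rewrite ae; card_lia.
pose s j := if unlift i j is Some j' then tnth t j' else a.
have s_in j' : tnth t j' \in e :\ a by rewrite -te inE mem_tnth.
exists s => [|j]; last first.
  rewrite /s; case: unliftP => // j' _ ta.
  by have := s_in j'; rewrite ta !inE eqxx.
apply/setP=> x; apply/imsetP/idP => [[j _ ->]|xe].
  rewrite /s; case: unliftP => // j' _.
  by have /setD1P[] := s_in j'.
case: (eqVneq x a) => [->|xa]; first by exists i; rewrite // /s unlift_none.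
have : x \in [set x in t] by rewrite te !inE xa.
rewrite inE => /tnthP[j' ->]; exists (lift i j') => //.
by rewrite /s liftK.
Qed.

(** A tuple outside the relation misses some colour i in a suitable strong
    colouring.  Reserving i for a point of the minimal hyperedge e maps the
    tuple to a proper subset of e, which is not a hyperedge. *)
Lemma forest_in_class_large (A : kstructure k) (E0 : {set {set A}}) (V : finType)
    (E : {set {set V}}) :
  2 < k -> K A -> kstructure_of E0 -> loop_free E0 -> E0 != set0 ->
  is_forest E -> uniform k E -> K (hypergraph_kstructure k E).
Proof.
move=> k2 KA [E0_hyp E0_k relA] E0_loop /set0Pn[e1 e1E] EF Ek.
have [e /minsetP[eE e_min] _] := @minset_exists _ (mem E0) e1 e1E.
have e_card : 1 < #|e| <= k.
  rewrite E0_k // andbT; have := E0_loop e eE.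
  have : #|e| != 0 by rewrite cards_eq0; apply: contraNneq E0_hyp => <-.
  by case: #|e| => [|[]].
have [a ae] : exists a, a \in e by apply/card_gt0P; case/andP: e_card => /ltnW.
have relE (t : k.-tuple A) : (t \in krel A) = ([set x in t] \in E0).
  by rewrite relA inE.
pose H := hypergraph_kstructure k E.
have hom c s : strong E c -> s @: [set: 'I_k] = e -> @homomorphism k H A (s \o c).
  move=> cE se t; rewrite inE => tE.
  rewrite relE set_map_tuple imset_comp.
  suff -> : c @: [set x in t] = setT by rewrite se.
  apply/eqP; rewrite eqEcard subsetT cardsT card_ord.
  by rewrite (card_in_imset (cE _ tE)) (Ek _ tE) leqnn.
have k0 : 0 < k by lia.
have [c0 c0E] := strong_exists k0 EF Ek.
apply: (in_class_of_homs K_sub K_prod KA).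
- have [s se _] := surjection_isolating (Ordinal k0) ae e_card.
  by exists (s \o c0); apply: hom.
- move=> x y xy; have [c cE cxy] := strong_separates k2 EF Ek xy.
  have [s se sa] := surjection_isolating (c x) ae e_card.
  have [j _ sj] : exists2 j, j \in setT & a = s j by apply/imsetP; rewrite se.
  exists (s \o c); first exact: hom.
  apply: contra cxy => /eqP /= sxy; have jx := sa j (esym sj).
  by apply/eqP/esym/sa; rewrite -sxy -jx.
move=> t; rewrite inE => tE.
have [c cE ct] : exists2 c : V -> 'I_k, strong E c & #|c @: ([set x in t] : {set V})| < k.
  case: (eqVneq #|[set x in t]| k) => [tk|tk].
    exact: strong_nonedge.
  exists c0 => //; apply: leq_ltn_trans (leq_imset_card _ _) _.
  by rewrite ltn_neqAle tk card_set_tuple.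
have [i it] : exists i, i \notin c @: [set x in t].
  have /subsetPn[i _ it] : ~~ (setT \subset c @: [set x in t]).
    apply/negP=> /subset_leq_card; rewrite cardsT card_ord leqNgt ct //.
  by exists i.
have [s se sa] := surjection_isolating i ae e_card.
exists (s \o c); first exact: hom.
rewrite relE set_map_tuple imset_comp.
set e' := s @: _; apply/negP=> e'E.
have e'e : e' \subset e by rewrite -se; apply: imsetS; apply: subsetT.
have ae' : a \in e' by rewrite (e_min _ e'E e'e).
case/imsetP: ae' => j jt aj; have ji := sa j (esym aj).
by rewrite -ji jt in it.
Qed.

End LargeArity.

(** * Forests in the class: graphs *)

Section Graphs.

Lemma tuple2_eta (T : Type) (t : 2.-tuple T) : exists x y, t = [tuple x; y].
Proof.
case: t => -[|x [|y []]] //= sz; exists x, y; exact: val_inj.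
Qed.

Lemma set_tuple2 (T : finType) (x y : T) : [set z in [tuple x; y]] = [set x; y].
Proof. by apply/setP=> z; rewrite !inE. Qed.

Lemma map_tuple2 (S T : Type) (f : S -> T) x y :
  map_tuple f [tuple x; y] = [tuple f x; f y].
Proof. exact: val_inj. Qed.

Definition adjacent (A : kstructure 2) (x y : A) : bool := [tuple x; y] \in krel A.

Variables (K : kstructure 2 -> Prop).
Hypotheses (K_sub : closed_under_substructures K) (K_prod : closed_under_products K).

(** Let L be one side of a bipartition.  Non-adjacent u in L and v outside L are
    sent to a and d, the rest of L to c and the rest of its complement to b.
    Vertices on the same side are not adjacent under L -> b, complement -> c.
    The vertices a and d may coincide, in which case a, b, c is a triangle. *)
Lemma forest_in_class_graph (A : kstructure 2) (a b c d : A) (V : finType)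
    (E : {set {set V}}) :
  K A -> symmetric (@adjacent A) -> irreflexive (@adjacent A) ->
  adjacent a b -> adjacent b c -> adjacent c d -> ~~ adjacent a d ->
  is_forest E -> uniform 2 E -> K (hypergraph_kstructure 2 E).
Proof.
move=> KA sym irr ab bc cd ad EF Ek.
pose H := hypergraph_kstructure 2 E.
have [col colE] := strong_exists (isT : 0 < 2) EF Ek.
pose L (v : V) := col v == ord0.
have symH : symmetric (@adjacent H).
  by move=> x y; rewrite /adjacent !inE !set_tuple2 setUC.
have L_adj x y : @adjacent H x y -> L x = ~~ L y.
  rewrite /adjacent inE set_tuple2 => xyE.
  have xy : x != y by have := Ek _ xyE; rewrite cards2; case: (x != y).
  have neq : col x != col y.
    apply: contraNneq xy => cxy; apply/eqP; apply: (colE _ xyE) => //; rewrite !inE eqxx ?orbT //.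
  rewrite /L; case: (col x) (col y) neq => [[|[|//]] p] [[|[|//]] p'] //.
have homI (h : H -> A) : (forall x y, L x -> ~~ L y -> @adjacent H x y -> adjacent (h x) (h y)) ->
    homomorphism h.
  move=> hL t; have [x [y ->]] := tuple2_eta t; rewrite map_tuple2.
  change (@adjacent H x y -> adjacent (h x) (h y)) => xy.
  have := L_adj x y xy; case: (boolP (L y)) => /= Ly Lx; last exact: hL.
  by rewrite sym; apply: hL; rewrite ?Lx // symH.
have neq_ac : a != c by apply: contraNneq ad => ->.
have neq_bd : b != d by apply: contraNneq ad => <-.
have neq_bc : b != c by apply: contraTneq bc => ->; rewrite irr.
pose h0 x := if L x then b else c.
have hom0 : @homomorphism 2 H A h0.
  by apply: homI => x y Lx Ly _; rewrite /h0 Lx (negbTE Ly).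
have homl u : L u -> @homomorphism 2 H A (fun x => if L x then (if x == u then a else c) else b).
  move=> Lu; apply: homI => x y -> /negbTE -> _; case: eqP => // _.
  by rewrite sym.
have homr u : ~~ L u -> @homomorphism 2 H A (fun x => if L x then c else (if x == u then d else b)).
  move=> Lu; apply: homI => x y -> /negbTE -> _; case: eqP => // _.
  by rewrite sym.
apply: (in_class_of_homs K_sub K_prod KA); first by exists h0.
  move=> x y xy; case: (boolP (L x)) => Lx; case: (boolP (L y)) => Ly.
  - by exists (fun z => if L z then (if z == x then a else c) else b);
      [exact: homl | rewrite Lx Ly eqxx (eq_sym y) (negbTE xy)].
  - by exists h0; rewrite // /h0 Lx (negbTE Ly).
  - by exists h0; rewrite // /h0 Ly (negbTE Lx) eq_sym.
  - exists (fun z => if L z then c else (if z == x then d else b)); first exact: homr.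
    by rewrite (negbTE Lx) (negbTE Ly) eqxx (eq_sym y) (negbTE xy) eq_sym.
move=> t; have [x [y ->]] := tuple2_eta t => nxy.
have cross u v : L u -> ~~ L v -> ~~ @adjacent H u v ->
    exists2 h : H -> A, homomorphism h & ~~ adjacent (h u) (h v).
  move=> Lu Lv nuv.
  exists (fun z => if L z then (if z == u then a else c) else (if z == v then d else b)).
    apply: homI => z w -> /negbTE -> zw; case: eqP => [zu|_]; case: eqP => [wv|_] //.
      by rewrite zu wv in zw; rewrite zw in nuv.
    by rewrite sym.
  by rewrite Lu (negbTE Lv) !eqxx.
case: (boolP (L x)) => Lx; case: (boolP (L y)) => Ly.
- by exists h0 => //; rewrite map_tuple2 /h0 Lx Ly; apply/negPf/irr.
- have [h hh hxy] := cross x y Lx Ly nxy.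
  by exists h; rewrite // map_tuple2.
- have [|h hh hxy] := cross y x Ly Lx; first by rewrite symH.
  by exists h; rewrite // map_tuple2 -[_ \in _]/(adjacent (h x) (h y)) sym.
- by exists h0 => //; rewrite map_tuple2 /h0 (negbTE Lx) (negbTE Ly); apply/negPf/irr.
Qed.

End Graphs.

(** * Graphs closed under walks of length three *)

Section CompleteBipartite.

Definition is_inl (S T : Type) (u : S + T) : bool := if u is inl _ then true else false.

Lemma complete_bipartite_adjacent (X Y : finType) (u v : X + Y) :
  @adjacent (complete_bipartite 2 X Y) u v = (is_inl u != is_inl v).
Proof.
rewrite /adjacent inE set_tuple2; apply/imsetP/idP => [[[x y] _ /= uv]|].
  have : inl x \in [set u; v] by rewrite uv !inE eqxx.
  have : inr y \in [set u; v] by rewrite uv !inE eqxx orbT.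
  by rewrite !inE; case: u {uv} => ?; case: v => ?; rewrite /= ?orbF.
case: u v => [x|y] [x'|y'] // _; first by exists (x, y').
by exists (x', y); rewrite // setUC.
Qed.

Lemma disjoint_union_adjacent (I : finType) (A : I -> kstructure 2)
    (u v : disjoint_union A) :
  reflect (exists (i : I) (x y : A i), [/\ adjacent x y, u = Tagged (fun i => carrier (A i)) x
    & v = Tagged (fun i => carrier (A i)) y])
    (adjacent u v).
Proof.
rewrite /adjacent inE; apply: (iffP existsP) => [[i /existsP[s /andP[sA /eqP]]]|].
  have [x [y es]] := tuple2_eta s; rewrite es in sA *.
  by rewrite map_tuple2 => -[-> ->]; exists i, x, y.
move=> [i [x [y [xy -> ->]]]]; exists i; apply/existsP; exists [tuple x; y].
by rewrite [_ \in _]xy map_tuple2 eqxx.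
Qed.

Lemma bipartite_union_adjacent (I : finType) (X Y : I -> finType)
    (u v : disjoint_union (fun i => complete_bipartite 2 (X i) (Y i))) :
  adjacent u v = (tag u == tag v) && (is_inl (tagged u) != is_inl (tagged v)).
Proof.
apply/disjoint_union_adjacent/andP => [[i [x [y [xy -> ->]]]]|].
  by rewrite -complete_bipartite_adjacent xy eqxx.
case: u v => [i x] [j y] /= [/eqP ij]; subst j => side.
by exists i, x, y; split; rewrite // complete_bipartite_adjacent.
Qed.

Variable (A : kstructure 2).
Hypotheses (sym : symmetric (@adjacent A)) (irr : irreflexive (@adjacent A)).
Hypothesis rectangular : forall a b c d : A,
  adjacent a b -> adjacent b c -> adjacent c d -> adjacent a d.

(** Closure under walks of length three makes the neighbourhoods of two vertices
    equal or disjoint.  The component of a non-isolated x is the union of the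
    neighbourhoods of x and of its neighbours, and one side of it is the
    neighbourhood of any chosen vertex r of the component.  All isolated
    vertices have the empty component, which has an empty right side. *)
Let N (x : A) : {set A} := [set y | adjacent x y].
Let component (x : A) : {set A} := N x :|: \bigcup_(y in N x) N y.
Let right_side (C : {set A}) : {set A} := if [pick r in C] is Some r then N r else set0.

Let N_meet x y z : adjacent x z -> adjacent y z -> N x = N y.
Proof.
move=> xz yz; apply/setP=> w; rewrite !inE; apply/idP/idP => [xw|yw].
  by apply: rectangular yz _ xw; rewrite sym.
by apply: rectangular xz _ yw; rewrite sym.
Qed.

Let component_edge x y : adjacent x y -> component x = N x :|: N y.
Proof.
move=> xy; congr (_ :|: _); apply/setP=> w; apply/bigcupP/idP => [[z]|wy].
  rewrite inE => xz; rewrite (@N_meet y z x) // sym //.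
by exists y; rewrite // inE.
Qed.

Let same_component x y : adjacent x y -> component x = component y.
Proof.
by move=> xy; rewrite (component_edge xy) (@component_edge y x) 1?sym // setUC.
Qed.

Let right_side_edge x y : adjacent x y ->
  (x \in right_side (component x)) = (y \notin right_side (component x)).
Proof.
move=> xy; rewrite /right_side; case: pickP => [r|]; last first.
  by move/(_ y); rewrite /= (component_edge xy) !inE xy.
have no_triangle : adjacent x r -> adjacent r y -> False.
  by move=> xr ry; have := rectangular xr ry (etrans (sym y x) xy); rewrite irr.
rewrite /= (component_edge xy) !inE => /orP[xr|yr].
  by rewrite (sym r x) xr; apply/esym/negP => /(no_triangle xr).
have ry : adjacent r y by rewrite sym.
by rewrite ry; apply/negP; rewrite sym => /no_triangle/(_ ry).
Qed.

Let right_side_adjacent x y : component x = component y ->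
  x \in right_side (component x) -> y \notin right_side (component x) ->
  adjacent x y.
Proof.
move=> eq_xy; rewrite /right_side; case: pickP => [r|]; last by rewrite inE.
rewrite /= eq_xy !inE => /orP[yr|/bigcupP[z yz zr]] rx ry.
  by rewrite sym yr in ry.
rewrite !inE in yz zr rx ry.
by rewrite sym; apply: rectangular yz zr rx.
Qed.

Let left_part (C : {set A}) : finType :=
  {x : A | (component x == C) && (x \notin right_side C)}.
Let right_part (C : {set A}) : finType :=
  {x : A | (component x == C) && (x \in right_side C)}.

Let bip (C : {set A}) : kstructure 2 :=
  complete_bipartite 2 (left_part C) (right_part C).

Let in_bip_left x (p : x \notin right_side (component x)) :
    (component x == component x) && (x \notin right_side (component x)).
Proof. by rewrite eqxx. Qed.

Let in_bip_right x (p : x \in right_side (component x)) :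
    (component x == component x) && (x \in right_side (component x)).
Proof. by rewrite eqxx. Qed.

Let which_side x :
  {x \in right_side (component x)} + {x \notin right_side (component x)}.
Proof. by case: (boolP (x \in _)) => side; [left | right]. Qed.

Let place_in (x : A) : bip (component x) :=
  match which_side x with
  | left p => inr (exist _ x (in_bip_right p))
  | right p => inl (exist _ x (in_bip_left p))
  end.

Let place (x : A) : disjoint_union bip := Tagged bip (place_in x).

Let unplace (u : disjoint_union bip) : A :=
  match tagged u with inl p => val p | inr p => val p end.

Let placeK : cancel place unplace.
Proof. by move=> x; rewrite /unplace /place /place_in /=; case: which_side. Qed.

Let unplaceK : cancel unplace place.
Proof.
move=> [C [[x px]|[x px]]]; rewrite /unplace /=.
  have /andP[/eqP eC xC] := px; subst C.
  rewrite /place /place_in; case: which_side => [p|p]; first by rewrite p in xC.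
  by rewrite (bool_irrelevance px (in_bip_left p)).
have /andP[/eqP eC xC] := px; subst C.
rewrite /place /place_in; case: which_side => [p|p]; last by case/negP: (p).
by rewrite (bool_irrelevance px (in_bip_right p)).
Qed.

Let place_in_side x : is_inl (place_in x) = (x \notin right_side (component x)).
Proof. by rewrite /place_in; case: which_side => p; rewrite ?p ?(negbTE p). Qed.

Lemma rectangular_bipartite : disjoint_union_of_complete_bipartite A.
Proof.
exists {set A}, left_part, right_part.
exists place; first by exists unplace.
move=> t; have [x [y ->]] := tuple2_eta t.
rewrite map_tuple2 -[LHS]/(adjacent x y).
rewrite -[RHS]/(@adjacent (disjoint_union bip) (place x) (place y)).
rewrite bipartite_union_adjacent /= !place_in_side.
apply/idP/andP => [xy|[/eqP eqC]].
  rewrite (same_component xy) eqxx -(same_component xy); split=> //.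
  by rewrite (right_side_edge xy) negbK; case: (_ \in _).
case: (boolP (x \in _)) => xC; case: (boolP (y \in _)) => // yC _.
  by apply: right_side_adjacent; rewrite // eqC.
by rewrite sym; apply: right_side_adjacent; rewrite // -eqC.
Qed.

End CompleteBipartite.

(** * Non-axiomatisability *)

Theorem corollary16 (k : nat) (K : kstructure k -> Prop)
  (K_hyp : class_of_loop_free_hypergraphs K)
  (K_sub : closed_under_substructures K)
  (K_prod : closed_under_products K)
  (K_chi : bounded_chromatic_number K)
  (K_case :
     (k = 2 /\
      exists2 A : kstructure k, K A & ~ disjoint_union_of_complete_bipartite A)
     \/
     (2 < k /\
      exists (A : kstructure k) (E : {set {set A}}),
        [/\ K A, kstructure_of E & E != set0])) :
  ~ finitely_axiomatisable_amongst_finite K.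
Proof.
have [k1 K_forest] : 1 < k /\ forall (V : finType) (E : {set {set V}}),
    is_forest E -> uniform k E -> K (hypergraph_kstructure k E).
  case: K_case => [[k2 [A KA]]|[k2 [A [E [KA AE E0]]]]].
    subst k; move=> notbip; split=> // V E EF Ek.
    have [F [F_hyp _ relF] F_loop] := K_hyp A KA.
    have adjF x y : adjacent x y = ([set x; y] \in F).
      by rewrite /adjacent relF inE set_tuple2.
    have sym : symmetric (@adjacent A) by move=> x y; rewrite !adjF setUC.
    have irr : irreflexive (@adjacent A).
      move=> x; rewrite adjF setUid; apply/negP => /F_loop.
      by rewrite cards1.
    case: (boolP [forall a : A, forall b : A, forall c : A, forall d : A,
      [&& adjacent a b, adjacent b c & adjacent c d] ==> adjacent a d]) => [rect|].
      case: notbip; apply: rectangular_bipartite => // a b c d ab bc cd.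
      move/forallP/(_ a)/forallP/(_ b)/forallP/(_ c)/forallP/(_ d)/implyP: rect.
      by apply; rewrite ab bc.
    rewrite negb_forall => /existsP[a]; rewrite negb_forall => /existsP[b].
    rewrite negb_forall => /existsP[c]; rewrite negb_forall => /existsP[d].
    rewrite negb_imply => /andP[/and3P[ab bc cd] ad].
    exact: (forest_in_class_graph K_sub K_prod KA sym irr ab bc cd ad).
  split=> [|V F FF Fk]; first exact: ltnW.
  have [F' AF' F'_loop] := K_hyp A KA.
  apply: (forest_in_class_large K_sub K_prod k2 KA AF' F'_loop) => //.
  have [E_hyp E_k relE] := AE; have [_ _ relF'] := AF'.
  have /set0Pn[e eE] := E0.
  have [|t te] := @tuple_of_set _ k e.
    by rewrite E_k // andbT card_gt0; apply: contraNneq E_hyp => <-.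
  have : t \in krel A by rewrite relE inE te.
  by rewrite relF' inE te => eF'; apply/set0Pn; exists e.
move=> [Sigma Sigma_ax].
pose m := \max_(phi <- Sigma) rank phi.
have rank_m phi : List.In phi Sigma -> rank phi <= m.
  rewrite /m; elim: (Sigma) => //= psi s IH; rewrite big_cons.
  by case=> [->|/IH le]; rewrite leq_max ?leqnn // le orbT.
have [N chi_N] := K_chi.
have [V [E [Ek El E_mono]]] := sparse_forces_mono N (radius m).*2.+1 k.
have E0 : set0 \notin E by apply/negP=> /Ek; rewrite cards0; lia.
pose A := hypergraph_kstructure k (labelled (@ball_edges V E m.+1 (radius m))).
pose B := hypergraph_kstructure k (labelled (@balls_and_whole V E m.+1 (radius m))).
have KA : K A.
  apply: K_forest; last first.
    by apply: labelled_uniform => p e /ball_edges_in; apply: Ek.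
  by apply: labelled_forest => p; apply: (ball_forest Ek k1 El).
have B_unif : uniform k (labelled (@balls_and_whole V E m.+1 (radius m))).
  by apply: labelled_uniform => -[p|] e //=; [move/ball_edges_in|]; apply: Ek.
have not_colourable l : l <= N -> ~ colourable (labelled (@balls_and_whole V E m.+1 (radius m))) l.
  move=> lN [c c2].
  have [e eE [a ea]] := E_mono (fun v => widen_ord lN (c (v, None))).
  have : 2 <= #|c @: layer None e|.
    by apply: c2; apply/labelledP; exists None; exists e.
  rewrite leqNgt ltnS; case/negP; apply/card_le1_eqP.
  move=> _ _ /imsetP[[u i] ue ->] /imsetP[[v j] ve ->].
  move: ue ve; rewrite !mem_layer => /andP[ue /eqP ->] /andP[ve /eqP ->].
  by apply: val_inj; have /(congr1 val) := etrans (ea u ue) (esym (ea v ve)).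
have nKB : ~ K B.
  move=> KB.
  have B_of : @kstructure_of k B (labelled (@balls_and_whole V E m.+1 (radius m))).
    split=> //; last by move=> e eE; rewrite B_unif.
    by rewrite /is_hypergraph; apply/negP=> /B_unif; rewrite cards0; lia.
  have [l [col _] lN] := chi_N B _ KB B_of.
  exact: (not_colourable l lN).
have [v0 _] : exists v : V, true.
  case: (pickP (@predT V)) => [v _|none]; first by exists v.
  have [e eE _] := E_mono (fun v => False_rect _ (Bool.diff_true_false (none v))).
  case: (set_0Vmem e) => [e0|[v _]]; last by exists v.
  by rewrite -e0 eE in E0.
apply/nKB/Sigma_ax => phi phi_S.
have [balls_whole _] := balls_equivalent E0 v0 (ltn0Sn m) (leqW (rank_m _ phi_S))
  (radius_leq (rank_m _ phi_S)).
exact/balls_whole/(proj2 (Sigma_ax A) KA).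
Qed.
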